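(* Let $\lambda=(\lambda_n)_{n\ge1}\in W_0$, put $\Lambda_n:=\lambda_1+\cdots+\lambda_n$, and assume that $\Lambda_n\to\infty$ and that $(\lambda_n/\Lambda_n)_{n\ge1}$ is nonincreasing with limit $\eta\in[0,1)$. Let $f\colon(0,\infty)\to\mathbb{R}$ be a concave function such that $\operatorname{sign}(f(x))=\operatorname{sign}(x-1)$ for all $x>0$. Then the homogeneous quasideviation mean $\mathscr{E}_f$ is $\lambda$-Hardy if and only if the function $x\mapsto f(1/x)$ is integrable over $(0,1]$. In the latter case, $c:=\mathscr{H}_\lambda(\mathscr{E}_f)$ is the unique solution $c\in(0,\infty)$ of the equation $$\int_0^1 f\Big(\frac1{cx}\Big)\,dx=0\quad\text{if }\eta=0,\qquad \sum_{k=0}^{\infty}(1-\eta)^k f\Big(\frac{1}{c(1-\eta)^k}\Big)=0\quad\text{if }\eta\in(0,1).$$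
   Context: $W_n$ is the set of $(\lambda_1,\dots,\lambda_n)\in\mathbb{R}^n$ with all $\lambda_i\ge0$ and $\lambda_1+\cdots+\lambda_n>0$; $W_0$ is the set of real sequences $(\lambda_n)_{n\ge1}$ with $\lambda_1>0$ and $\lambda_n\ge0$ for $n\ge2$. The mean $\mathscr{E}_f\colon\bigcup_{n\ge1}(0,\infty)^n\times W_n\to(0,\infty)$: for $f$ as in the claim it is known that for every $n$ and $(x,\lambda)\in(0,\infty)^n\times W_n$ the equation $\lambda_1f(x_1/y)+\cdots+\lambda_nf(x_n/y)=0$ has a unique solution $y>0$; $\mathscr{E}_f(x,\lambda)$ denotes this solution. Hardy constant: $\mathscr{H}_\lambda(\mathscr{E}_f)$ is the smallest extended real number $C$ such that $\sum_{n=1}^\infty\lambda_n\,\mathscr{E}_f\big((x_1,\dots,x_n),(\lambda_1,\dots,\lambda_n)\big)\le C\sum_{n=1}^\infty\lambda_nx_n$ for all sequences $(x_n)$ in $(0,\infty)$. $\mathscr{E}_f$ is $\lambda$-Hardy if $\mathscr{H}_\lambda(\mathscr{E}_f)<\infty$. *)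

(* Defs.v *)
From HB Require Import structures.
From mathcomp Require Import all_boot all_order all_algebra.
From mathcomp Require Import all_classical all_reals all_analysis.
Set Implicit Arguments.
Unset Strict Implicit.
Unset Printing Implicit Defensive.
Import Order.TTheory GRing.Theory Num.Theory.
Import numFieldNormedType.Exports.
Local Open Scope classical_set_scope.
Local Open Scope ring_scope.

Section defs.
Variable R : realType.

(* Real sequences are indexed from 0: the n-th term of a sequence (u_n)_{n >= 1}
   is [u n.-1]. *)

Definition W0 : set (R^nat) := [set l | 0 < l 0 /\ forall n, 0 <= l n].

(* [Lambda l n] is the sum of the first n.+1 weights. *)
Definition Lambda (l : R^nat) (n : nat) : R := \sum_(i < n.+1) l i.

Definition concave_function (D : set R) (f : R -> R) : Prop :=
  convex_function (E := R^o) D (fun x => - f x).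

(* A weighted mean: [M n x l] is only meaningful for n >= 1, x with positive
   entries and l with nonnegative entries and positive sum. *)
Definition weighted_mean := forall n : nat, ('I_n -> R) -> ('I_n -> R) -> R.

(* For f concave on ]0, +oo[ with the sign of x - 1, the equation has exactly
   one positive solution whenever the mean is meaningful, so the default value 1
   of [xget] is never used there. *)
Definition qdev_mean (f : R -> R) : weighted_mean := fun n x l =>
  xget 1 [set y : R | 0 < y /\ \sum_(i < n) l i * f (x i / y) = 0].

(* (u_1, ..., u_n) in 1-based numbering. *)
Definition first_terms (u : R^nat) (n : nat) (i : 'I_n) : R := u i.

Definition hardy_bound (l : R^nat) (M : weighted_mean) (C : \bar R) : Prop :=
  forall x : R^nat, (forall n, 0 < x n) ->
    (\sum_(0 <= n <oo)
        (l n * M n.+1 (@first_terms x n.+1) (@first_terms l n.+1))%:E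
      <= C * \sum_(0 <= n <oo) (l n * x n)%:E)%E.

Definition is_hardy_constant (l : R^nat) (M : weighted_mean) (C : \bar R) :=
  hardy_bound l M C /\ forall C', hardy_bound l M C' -> (C <= C')%E.

Definition is_hardy (l : R^nat) (M : weighted_mean) : Prop :=
  exists2 C, is_hardy_constant l M C & (C < +oo)%E.

(* Convergence of the series to 0 is part of the equation when eta > 0. *)
Definition hardy_equation (f : R -> R) (eta c : R) : Prop :=
  if eta == 0 then
    (\int[lebesgue_measure]_(x in `]0%R, 1%R]) (f (c * x)^-1)%:E = 0)%E
  else
    series (fun k => (1 - eta) ^+ k * f (c * (1 - eta) ^+ k)^-1) @ \oo --> (0 : R).

End defs.

(* Main.v *)
Require Import Defs.
From mathcomp Require Import all_boot all_order all_algebra.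
From mathcomp Require Import all_classical all_reals all_analysis.
From mathcomp Require Import measurable_realfun lra ring.
Import Order.TTheory GRing.Theory Num.Theory.
Import numFieldNormedType.Exports.
Local Open Scope classical_set_scope.
Local Open Scope ring_scope.

Set Implicit Arguments.
Unset Strict Implicit.

(** Write theta_n = lambda_n / Lambda_n, h_c(u) = f(1/(c u)), and F_N(c) for the
    sum over j <= N of lambda_j h_c(Lambda_j / Lambda_N).

    Upper bound: if F_N(c) <= 0 for all N, then c bounds all partial sums. Linearize f at
    the points Lambda_N / (c Lambda_j), with intercepts q_j and slopes p_j, and average
    these tangents along a Markov chain which started at time k with the weights
    lambda_0, ..., lambda_k has the weights lambda_0, ..., lambda_N at time N; its
    transition probabilities theta_{k+1} / theta_i are at most 1 because theta is
    nonincreasing. F_N(c) is a right Riemann sum of the nonincreasing function h_c, hence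
    at most Lambda_N times its integral; for eta > 0 concavity of u f(1/(cu)) replaces
    the partition by the geometric one of ratio 1 - eta.

    Lower bound: testing a Hardy bound b on x_n = 1 / Lambda_n, truncated far away, shows
    by Abel-Dini that F_k(b') <= 0 for infinitely many k whenever b' > b, and letting
    k tend to infinity bounds the integral or the series by 0.

    Finally c times the left side of the equation is concave in c, positive for c <= 1
    and negative somewhere, so it has exactly one root, which separates the two regimes. *)

Lemma sum_ord_gt0 (R : numDomainType) n (F : 'I_n -> R) i0 :
  (forall i, 0 <= F i) -> 0 < F i0 -> 0 < \sum_(i < n) F i.
Proof.
by move=> F0 Fi; rewrite (bigD1 i0)//= ltr_pwDl// sumr_ge0// => i _; exact: F0.
Qed.

(** * Roots and signs of functions satisfying the chord inequality *)

Section concave_chords.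
Variable R : realType.
Implicit Types (f g : R -> R) (D : set R).

(* Division-free three-point form of concavity, stable under sums and integrals. *)
Definition chord_concave D g := forall x y z, D x -> D z -> x < y -> y < z ->
  (z - y) * g x + (y - x) * g z <= (z - x) * g y.

Lemma concave_function_chord D f : concave_function D f -> chord_concave D f.
Proof.
move=> cf x y z Dx Dz xy yz.
have zx0 : 0 < z - x by lra.
have t01 : 0 <= (y - x) / (z - x) <= 1.
  apply/andP; split; first by rewrite divr_ge0//; lra.
  by rewrite ler_pdivrMr// mul1r; lra.
pose t := (y - x) / (z - x).
have : - f (t * z + (1 - t) * x) <= t * - f z + (1 - t) * - f x.
  exact: (cf (Itv01 (andP t01).1 (andP t01).2) z x (mem_set Dz) (mem_set Dx)).
have -> : t * z + (1 - t) * x = y by rewrite /t; field; rewrite gt_eqF.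
rewrite -(ler_pM2l zx0).
have -> : (z - x) * (t * - f z + (1 - t) * - f x) =
    - ((z - y) * f x + (y - x) * f z).
  by rewrite /t; field; rewrite gt_eqF.
by rewrite mulrN lerN2.
Qed.

(** Concavity does the work of continuity: [s] is the supremum of the points of [a, m] where [g] is
    nonnegative, a chord ending at [m + 1] excludes [g s < 0], and the chord from [s] to [m]
    excludes [g s > 0]. *)
Lemma chord_concave_root g (a m : R) : chord_concave [set x | a <= x] g ->
  a < m -> 0 < g a -> g m < 0 -> exists2 s, a < s & g s = 0.
Proof.
move=> cg am ga gm.
pose S := [set t | a <= t <= m /\ 0 <= g t].
have Sa : S a by split; [lra | exact: ltW].
have Sm : ubound S m by move=> t [/andP[]].
have hS : has_sup S by split; [exists a | exists m].
pose s := sup S.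
have as_ : a <= s by apply: sup_upper_bound.
have sm : s <= m by apply: ge_sup => //; exists a.
have gs0 : 0 <= g s.
  rewrite leNgt; apply/negP => gs.
  have gB : g (m + 1) < 0.
    have : (m + 1 - m) * g a + (m - a) * g (m + 1) <= (m + 1 - a) * g m.
      by apply: cg => //=; lra.
    move=> H; rewrite ltNge; apply/negP => H1.
    have : (m - a) * g (m + 1) >= 0 by rewrite mulr_ge0//; lra.
    have : (m + 1 - a) * g m < 0 by rewrite nmulr_llt0//; lra.
    lra.
  (* The chord from any [t < s] with [0 <= g t] to [m + 1] lies below [g] at [s], which forces
     [s - t >= e] and contradicts adherence. The endpoint [m + 1] leaves room even when [s = m]. *)
  pose e := g s / g (m + 1) * (m + 1 - s).
  have e0 : 0 < e.
    rewrite /e mulr_gt0//; last lra.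
    by rewrite -divrNN divr_gt0 ?oppr_gt0.
  have [t [/andP[at_ tm] gt0] st] := sup_adherent e0 hS.
  have ts : t <= s by apply: sup_upper_bound => //; split => //; apply/andP.
  have {ts} : t < s by rewrite lt_neqAle ts andbT; apply/eqP => E; move: gt0; rewrite E; lra.
  move=> ts.
  have H : (m + 1 - s) * g t + (s - t) * g (m + 1) <= (m + 1 - t) * g s.
    by apply: cg => //=; lra.
  have H1 : (s - t) * g (m + 1) <= (m + 1 - s) * g s.
    have : (m + 1 - s) * g t >= 0 by rewrite mulr_ge0//; lra.
    have : (s - t) * g s < 0 by rewrite pmulr_rlt0//; lra.
    have E : (m + 1 - t) * g s = (m + 1 - s) * g s + (s - t) * g s by ring.
    lra.
  have : (s - t) >= e.
    by rewrite /e mulrAC ler_ndivrMr// [leRHS]mulrC mulrC; move: H1; rewrite mulrC.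
  by rewrite -/s in st; lra.
have gs_le0 : g s <= 0.
  rewrite leNgt; apply/negP => gs.
  have sm' : s < m by rewrite lt_neqAle sm andbT; apply/eqP => E; move: gs; rewrite E; lra.
  (* The point [t] below is the zero of the chord from [s] to [m], so [g] is nonnegative beyond its
     supremum [s]. *)
  pose w := g s / (g s - g m).
  have w0 : 0 < w by rewrite divr_gt0//; lra.
  have w1 : w < 1 by rewrite ltr_pdivrMr; lra.
  pose t := s + w * (m - s).
  have st : s < t by rewrite /t ltrDl mulr_gt0//; lra.
  have tm : t < m.
    have : w * (m - s) < 1 * (m - s) by rewrite ltr_pM2r// subr_gt0.
    rewrite /t; lra.
  have := cg s t m _ _ st tm => /(_ as_ (ltW am)).
  have -> : (m - t) * g s + (t - s) * g m = 0.
    have gne : g s - g m != 0 by rewrite gt_eqF//; lra.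
    by rewrite /t /w; field.
  rewrite pmulr_rge0; last lra.
  move=> gt0.
  have : t <= s by apply: sup_upper_bound => //; split => //; lra.
  lra.
exists s; last by apply/eqP; rewrite eq_le gs_le0.
rewrite lt_neqAle as_ andbT; apply/eqP => E; move: gs_le0; rewrite -E; lra.
Qed.

Lemma chord_concave_sign g (b c : R) : chord_concave [set x | 1 <= x] g ->
  0 < g 1 -> 1 <= b -> b < c -> 0 <= g c -> 0 < g b.
Proof.
move=> cg g1; rewrite le_eqVlt => /predU1P[<-//|b1] bc gc.
have : (c - b) * g 1 + (b - 1) * g c <= (c - 1) * g b by apply: cg => //=; lra.
have : 0 < (c - b) * g 1 by rewrite mulr_gt0//; lra.
have : 0 <= (b - 1) * g c by rewrite mulr_ge0//; lra.
move=> H1 H2 H3; have : 0 < (c - 1) * g b by lra.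
by rewrite pmulr_rgt0//; lra.
Qed.

End concave_chords.

(** * Monotonicity, tangents, perspective and dilation of the deviation *)

Section deviation.
Variables (R : realType) (f : R -> R).
Hypothesis f_chord : chord_concave [set x | 0 < x] f.
Hypothesis f_sign : forall x : R, 0 < x -> Num.sg (f x) = Num.sg (x - 1).

Lemma dev1 : f 1 = 0.
Proof. by apply/eqP; rewrite -sgr_eq0 f_sign// subrr sgr0. Qed.

Lemma dev_gt0 x : 1 < x -> 0 < f x.
Proof. by move=> x1; rewrite -sgr_cp0 f_sign ?gtr0_sg ?subr_gt0//; lra. Qed.

Lemma dev_lt0 x : 0 < x -> x < 1 -> f x < 0.
Proof. by move=> x0 x1; rewrite -sgr_cp0 f_sign// ltr0_sg// subr_lt0. Qed.

(** A strict decrease between two points would, by concavity, drive [f] to minus infinity, but [f]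
    is positive beyond 1. *)
Lemma dev_mono x y : 0 < x -> x <= y -> f x <= f y.
Proof.
move=> x0; rewrite le_eqVlt => /predU1P[->//|xy].
rewrite leNgt; apply/negP => fyx.
pose d := f x - f y; have d0 : 0 < d by rewrite /d; lra.
(* The line through the graph points at [x] and [y] is negative at this [z]; the summand [y + 1]
   also puts [z] beyond [y] and beyond 1. *)
pose z := `|y * f x - x * f y| / d + y + 1.
have Hn : 0 <= `|y * f x - x * f y| / d by rewrite divr_ge0// ltW.
have yz : y < z by rewrite /z; lra.
have fz : 0 < f z by apply: dev_gt0; rewrite /z; lra.
have H : (z - y) * f x + (y - x) * f z <= (z - x) * f y.
  by apply: f_chord => //=; lra.
have H1 : 0 < (y - x) * f z by rewrite mulr_gt0//; lra.
have H2 : z * d < y * f x - x * f y by rewrite /d; lra.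
have : z * d = `|y * f x - x * f y| + (y + 1) * d.
  by rewrite /z; field; rewrite gt_eqF.
have := ler_norm (y * f x - x * f y).
have : 0 < (y + 1) * d by rewrite mulr_gt0//; lra.
lra.
Qed.

Lemma dev_ge0 x : 1 <= x -> 0 <= f x.
Proof. by move=> x1; rewrite -dev1 dev_mono. Qed.

(** The slope is the supremum of the chord slopes to the right of [a], which every chord slope to
    the left bounds from above. *)
Lemma dev_supergradient a : 0 < a ->
  exists2 p, 0 <= p & forall x, 0 < x -> f x <= f a + p * (x - a).
Proof.
move=> a0.
pose S := [set (f y - f a) / (y - a) | y in [set y | a < y]].
have key x y : 0 < x -> x < a -> a < y -> (f y - f a) / (y - a) <= (f a - f x) / (a - x).
  move=> x0 xa ay.
  rewrite ler_pdivrMr ?subr_gt0// mulrAC ler_pdivlMr ?subr_gt0//.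
  have : (y - a) * f x + (a - x) * f y <= (y - x) * f a by apply: f_chord => //=; lra.
  lra.
have S0 : S !=set0 by exists ((f (a + 1) - f a) / (a + 1 - a)); exists (a + 1) => //=; lra.
have ubS x : 0 < x -> x < a -> ubound S ((f a - f x) / (a - x)).
  by move=> x0 xa _ [y ay <-]; exact: key.
have hS : has_sup S by split => //; exists ((f a - f (a / 2)) / (a - a / 2)); apply: ubS; lra.
exists (sup S).
  apply: le_trans (_ : 0 <= (f (a + 1) - f a) / (a + 1 - a)) _.
    by rewrite divr_ge0 ?subr_ge0 ?dev_mono//; lra.
  by apply: sup_upper_bound => //; exists (a + 1) => //=; lra.
move=> x x0; case: (ltgtP x a) => [xa|ax|->]; last by rewrite subrr mulr0 addr0.
- have : sup S <= (f a - f x) / (a - x) by apply: ge_sup => //; exact: ubS.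
  by rewrite ler_pdivlMr ?subr_gt0//; lra.
- have : (f x - f a) / (x - a) <= sup S by apply: sup_upper_bound => //; exists x.
  by rewrite ler_pdivrMr ?subr_gt0//; lra.
Qed.

(* The perspective y f(x/y) of a concave function is concave; monotonicity
   covers the endpoint 0, where it takes the junk value 0. *)
Lemma dev_perspective x : 0 < x -> chord_concave [set y | 0 <= y] (fun y => y * f (x / y)).
Proof.
move=> x0 w y z /= w0 z0 wy yz.
have y0 : 0 < y by lra.
have {}z0 : 0 < z by lra.
move: w0; rewrite le_eqVlt => /predU1P[w0|w0].
  rewrite -w0 mul0r mulr0 add0r !subr0 mulrCA ler_pM2l// ler_pM2l//.
  by rewrite dev_mono ?divr_gt0// ler_pM2l// lef_pV2 ?posrE// ltW.
have H : (x / w - x / y) * f (x / z) + (x / y - x / z) * f (x / w) <=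
         (x / w - x / z) * f (x / y).
  by apply: f_chord; rewrite /= ?divr_gt0// ltr_pM2l// ltf_pV2 ?posrE.
have K : 0 < w * y * z / x by rewrite divr_gt0// !mulr_gt0.
move: H; rewrite -(ler_pM2l K).
have -> : w * y * z / x * ((x / w - x / z) * f (x / y)) = (z - w) * (y * f (x / y)).
  by field; rewrite !gt_eqF.
have -> : w * y * z / x * ((x / w - x / y) * f (x / z) + (x / y - x / z) * f (x / w)) =
  (z - y) * (w * f (x / w)) + (y - w) * (z * f (x / z)).
  by field; rewrite !gt_eqF.
by [].
Qed.

(** Scaling the argument costs a factor and a constant, so neither integrability nor summability
    depends on the scale. For [t > 2 * b], chords from the zero of [f] at 1 have decreasing slopes,
    and [(t - 1) / (t / b - 1) <= 2 * b]. *)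
Lemma dev_dilation b t : 1 <= b -> 0 < t ->
  f t <= 2 * b * Num.max (f (t / b)) 0 + f (2 * b).
Proof.
move=> b1 t0.
have b0 : 0 < b by lra.
have f2b : 0 <= f (2 * b) by apply: dev_ge0; lra.
have [t2|t2] := leP t (2 * b).
  apply: le_trans (dev_mono t0 t2) _.
  by rewrite lerDr !mulr_ge0 ?le_max ?lexx ?orbT//; lra.
have u2 : 2 < t / b by rewrite ltr_pdivlMr.
rewrite max_l; last by apply: dev_ge0; lra.
move: b1; rewrite le_eqVlt => /predU1P[b1|b1].
  by rewrite -b1 divr1 in f2b u2 *; have := @dev_ge0 t; lra.
set u := t / b in u2 *.
have tE : t = u * b by rewrite /u divfK// gt_eqF.
have ut : u < t by rewrite tE ltr_pMr//; lra.
have H : (t - u) * f 1 + (u - 1) * f t <= (t - 1) * f u by apply: f_chord => /=; lra.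
rewrite dev1 mulr0 add0r in H.
have fu : 0 <= f u by apply: dev_ge0; lra.
have : (u - 1) * f t <= (u - 1) * (2 * b * f u).
  apply: le_trans H _; rewrite mulrA ler_wpM2r//.
  rewrite tE; have : 0 <= (u - 2) * b by rewrite mulr_ge0//; lra.
  lra.
rewrite ler_pM2l; lra.
Qed.

End deviation.

(** * A Markov chain transporting the weights *)

Section kedlaya_chain.
Variables (R : realType) (l : R^nat).
Hypothesis l_gt0 : forall n, 0 < l n.

Local Notation L := (Lambda l).
Local Notation theta n := (l n / L n).

Lemma Lambda0 : L 0 = l 0.
Proof. by rewrite /Lambda big_ord1. Qed.

Lemma LambdaS n : L n.+1 = L n + l n.+1.
Proof. by rewrite /Lambda big_ord_recr. Qed.

Lemma Lambda_gt0 n : 0 < L n.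
Proof.
by elim: n => [|n IH]; rewrite ?Lambda0// LambdaS addr_gt0.
Qed.

Lemma Lambda_neq0 n : L n != 0.
Proof. by rewrite gt_eqF// Lambda_gt0. Qed.

Lemma theta_gt0 n : 0 < theta n.
Proof. by rewrite divr_gt0// Lambda_gt0. Qed.

Lemma theta_onem n : 1 - theta n.+1 = L n / L n.+1.
Proof. by have := Lambda_neq0 n.+1; rewrite LambdaS => H; field. Qed.

(* Expected value of [g] at time [k + n] for the Markov chain that is in state
   [i] at time [k] and moves, at time [k], from a state [i] to [i.+1] with
   probability [theta k.+1 / theta i]. *)
Fixpoint chain_mean (g : nat -> R) k n i : R :=
  if n is n'.+1 then
    (1 - theta k.+1 / theta i) * chain_mean g k.+1 n' i +
    theta k.+1 / theta i * chain_mean g k.+1 n' i.+1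
  else g i.

Lemma chain_mean_linear (a b : nat -> R) (X : R) k n i :
  chain_mean (fun j => a j + X * b j) k n i =
  chain_mean a k n i + X * chain_mean b k n i.
Proof. by elim: n k i => [|n IH] k i //=; rewrite !IH; ring. Qed.

(** Since [l i / theta i = L i], state [i] sends mass [t * L i] upwards and receives the mass sent
    by the state below, a net loss of [t * l i]; the mass [t * L k] enters the new state [k.+1]. *)
Lemma chain_mean_step_sum (t : R) (u : nat -> R) k :
  \sum_(i < k.+1) l i * ((1 - t / theta i) * u i + t / theta i * u i.+1) =
  (1 - t) * \sum_(i < k.+1) l i * u i + t * L k * u k.+1.
Proof.
have l0 n : l n != 0 by rewrite gt_eqF.
elim: k => [|k IH].
  by rewrite !big_ord1 /= Lambda0; field; rewrite l0.
rewrite big_ord_recr /= IH [in RHS]big_ord_recr /=.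
have := Lambda_neq0 k.+1; rewrite LambdaS => H.
by field; rewrite l0 H.
Qed.

(** With [t = theta k.+1], one step turns the weights up to [k] into [L k / L k.+1] times the
    weights up to [k.+1]; these factors telescope. *)
Lemma chain_mean_sum g k n :
  \sum_(i < k.+1) l i * chain_mean g k n i =
  L k / L (k + n) * \sum_(j < (k + n).+1) l j * g j.
Proof.
elim: n k => [|n IH] k /=; first by rewrite addn0 divff ?mul1r// Lambda_neq0.
rewrite chain_mean_step_sum theta_onem.
have -> : theta k.+1 * L k = L k / L k.+1 * l k.+1 by ring.
rewrite -mulrA -mulrDr.
have := IH k.+1; rewrite big_ord_recr /= => ->.
rewrite addSnnS; have := Lambda_neq0 k.+1; have := Lambda_neq0 (k + n.+1) => H H'.
by field; rewrite H H'.
Qed.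

(** The state [i] and the final time [i + n] are fixed while the start time varies. Weighted by
    [theta i], one step of the chain is a difference in the start time, so passing from [i] to
    [i.+1] telescopes. *)
Lemma chain_mean_occupation g n i :
  \sum_(m < n.+1) theta (i + m)%N * chain_mean g (i + m) (n - m) i =
  \sum_(m < n.+1) theta (i + m)%N * g (i + m)%N.
Proof.
elim: n i => [|n IH] i; first by rewrite !big_ord1 addn0.
rewrite [RHS]big_ord_recl /= addn0.
have -> : \sum_(m < n.+1) theta (i + bump 0 m)%N * g (i + bump 0 m)%N =
    \sum_(m < n.+1) theta (i.+1 + m)%N * g (i.+1 + m)%N.
  by apply: eq_bigr => m _; rewrite /bump /= add1n addnS addSn.
rewrite -IH.
pose t m := chain_mean g (i + m) (n.+1 - m) i.
rewrite (eq_bigr (fun m : 'I_n.+2 => theta (i + m)%N * t m))//.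
have t_end : t n.+1 = g i by rewrite /t subnn.
(* One step of the chain, solved for the branch that moves to [i.+1]. *)
have step (m : 'I_n.+1) : theta (i.+1 + m)%N * chain_mean g (i.+1 + m) (n - m) i.+1 =
    theta (i + m.+1)%N * t m.+1 + theta i * (t m - t m.+1).
  have ti : theta i != 0 by rewrite gt_eqF// theta_gt0.
  have -> : t m = (1 - theta (i + m).+1 / theta i) * t m.+1 +
      theta (i + m).+1 / theta i * chain_mean g (i.+1 + m) (n - m) i.+1.
    have nm : (n.+1 - m)%N = (n - m).+1 by rewrite subSn// -ltnS.
    by rewrite /t nm subSS addnS addSn.
  rewrite addnS addSn.
  by move: ti (t m.+1) => /[swap] u; move: (theta i) => s s0; field; rewrite s0 Lambda_neq0.
rewrite (eq_bigr _ (fun m _ => step m)) big_split /= -mulr_sumr.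
have -> : \sum_(m < n.+1) (t m - t m.+1) = t 0%N - t n.+1.
  by rewrite -opprB -telescope_sumr// big_mkord -sumrN; apply: eq_bigr => m _; rewrite opprB.
rewrite t_end big_ord_recl /= addn0.
rewrite (eq_bigr (fun m : 'I_n.+1 => theta (i + m.+1)%N * t m.+1))//.
by ring.
Qed.

Hypothesis theta_nincr : nonincreasing_seq (fun n => theta n).

(** Monotonicity of the ratios enters here: [i <= k] persists along the chain, so each transition
    probability is at most 1 and each step is a convex combination. *)
Lemma chain_mean_ge g (c : R) k n i : (i <= k)%N -> (forall j, c <= g j) ->
  c <= chain_mean g k n i.
Proof.
move=> ik cg; elim: n k i ik => [|n IH] k i ik //=.
have H1 := IH k.+1 i (leqW ik); have H2 := IH k.+1 i.+1 ik.
have t0 : 0 <= theta k.+1 / theta i by rewrite divr_ge0// ltW// theta_gt0.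
have t1 : theta k.+1 / theta i <= 1.
  by rewrite ler_pdivrMr ?theta_gt0// mul1r; apply: theta_nincr; rewrite leqW.
move: t0 t1; set t := theta k.+1 / theta i => t0 t1.
have : 0 <= (1 - t) * (chain_mean g k.+1 n i - c) by rewrite mulr_ge0//; lra.
have : 0 <= t * (chain_mean g k.+1 n i.+1 - c) by rewrite mulr_ge0//; lra.
lra.
Qed.

(** Both sides are sums over the triangle [i <= k <= N]; for each [i] they agree by the occupation
    identity. *)
Lemma chain_mean_occupation_sum (g w : nat -> R) N :
  \sum_(k < N.+1) theta k * (\sum_(i < k.+1) w i * chain_mean g k (N - k) i) =
  \sum_(j < N.+1) theta j * g j * (\sum_(i < j.+1) w i).
Proof.
have tri (F : nat -> nat -> R) :
    \sum_(k < N.+1) \sum_(i < k.+1) F i k =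
    \sum_(i < N.+1) \sum_(m < (N - i).+1) F i (i + m)%N.
  have shift i (G : nat -> R) : (i <= N)%N ->
      \sum_(k < N.+1 | (i < k.+1)%N) G k = \sum_(m < (N - i).+1) G (i + m)%N.
    move=> iN; rewrite -(big_mkord (fun k => (i < k.+1)%N) G).
    rewrite (big_cat_nat (n := i))//=; last exact: leqW.
    rewrite big_nat_cond big1 ?add0r; last first.
      by move=> k /andP[/andP[_ ki] ]; rewrite ltnS leqNgt ki.
    rewrite -{1}(add0n i) big_addn subSn// big_mkord.
    by apply: eq_big => m; rewrite addnC// ltnS leq_addr.
  under eq_bigr => k _ do rewrite (big_ord_widen N.+1 (fun i => F i k))//.
  rewrite (exchange_big_dep xpredT)//=; apply: eq_bigr => i _.
  by rewrite (shift _ (F i))// -ltnS.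
transitivity (\sum_(k < N.+1) \sum_(i < k.+1) theta k * (w i * chain_mean g k (N - k) i)).
  by apply: eq_bigr => k _; rewrite mulr_sumr.
rewrite (tri (fun i k => theta k * (w i * chain_mean g k (N - k) i))).
transitivity (\sum_(j < N.+1) \sum_(i < j.+1) theta j * g j * w i); last first.
  by apply: eq_bigr => k _; rewrite mulr_sumr.
rewrite (tri (fun i k => theta k * g k * w i)); apply: eq_bigr => i _.
rewrite -mulr_suml -chain_mean_occupation mulr_suml; apply: eq_bigr => m _.
by rewrite subnDA mulrCA mulrC.
Qed.

End kedlaya_chain.

(** * The Hardy inequality for partial sums *)

Section hardy_upper_bound.
Variables (R : realType) (f : R -> R) (l : R^nat).
Hypothesis f_chord : chord_concave [set x | 0 < x] f.
Hypothesis f_sign : forall x : R, 0 < x -> Num.sg (f x) = Num.sg (x - 1).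
Hypothesis l_gt0 : forall n, 0 < l n.
Hypothesis theta_nincr : nonincreasing_seq (fun n => l n / Lambda l n).
Local Notation L := (Lambda l).
Local Notation theta n := (l n / L n).

Lemma hardy_partial_sums (x y : R^nat) (c : R) N : 0 < c ->
  (forall n, 0 < x n) ->
  (forall n, 0 < y n /\ \sum_(i < n.+1) l i * f (x i / y n) = 0) ->
  \sum_(j < N.+1) l j * f (L N / (c * L j)) <= 0 ->
  \sum_(k < N.+1) l k * y k <= c * \sum_(k < N.+1) l k * x k.
Proof.
move=> c0 x0 yP aN.
have L0 n : 0 < L n by apply: Lambda_gt0.
(* Tangents are taken at the arguments of [f] in the hypothesis on [c], with slopes [p j] and
   intercepts [q j]. *)
pose a j := L N / (c * L j).
have a0 j : 0 < a j by rewrite divr_gt0// mulr_gt0.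
have /choice[p pP] j : exists p, 0 <= p /\ forall x, 0 < x -> f x <= f (a j) + p * (x - a j).
  by have [p p0 pP] := dev_supergradient f_chord f_sign (a0 j); exists p.
pose q j := f (a j) - p j * a j.
pose P := \sum_(j < N.+1) theta j * p j.
have S0 n : 0 <= \sum_(i < n.+1) l i * x i by apply: sumr_ge0 => i _; rewrite mulr_ge0 ?ltW.
(* [P] is cancelled at the end. As [a] decreases, the hypothesis on [c] forces [f (a N) <= 0], and a
   tangent at such a point has positive slope because [f 2 > 0]. *)
have P0 : 0 < P.
  have aN1 : f (a N) <= 0.
    rewrite leNgt; apply/negP => faN; move: aN; rewrite leNgt => /negP; apply.
    apply: (@sum_ord_gt0 _ _ _ ord_max) => [i|]; last by rewrite mulr_gt0.
      rewrite mulr_ge0 ?ltW//; apply: lt_le_trans faN _.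
      apply: (dev_mono f_chord f_sign); first exact: a0.
      rewrite /a ler_pM2l// lef_pV2 ?posrE ?mulr_gt0// ler_pM2l//.
      rewrite /Lambda (big_ord_widen N.+1 (fun i => l i))//.
      by rewrite [leRHS](bigID (fun j : 'I_N.+1 => (j < i.+1)%N))/= lerDl sumr_ge0// => j _; rewrite ltW.
  have pN : 0 < p N.
    rewrite lt_neqAle (pP N).1 andbT eq_sym; apply/eqP => pN0.
    have := (pP N).2 2 ltac:(lra); rewrite pN0 mul0r addr0.
    have := dev_gt0 f_sign (x := 2) ltac:(lra); lra.
  rewrite /P big_ord_recr /= ltr_wpDl ?(mulr_gt0 (theta_gt0 l_gt0 N) pN)//.
  by apply: sumr_ge0 => i _; rewrite mulr_ge0 ?(pP _).1// ltW// theta_gt0.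
have key (k : 'I_N.+1) : l k * y k * (- (\sum_(j < N.+1) l j * q j) / L N) <=
    theta k * (\sum_(i < k.+1) l i * x i * chain_mean l p k (N - k) i).
  have [yk0 yk] := yP k.
  have kN : (k + (N - k))%N = N by rewrite subnKC// -ltnS.
  (* Every tangent lies above [f] at [x i / y k], hence so does the mean of the tangents along the
     chain from state [i] at time [k] to time [N]; the equation of [y k] gives the sign of the
     total. *)
  have H : 0 <= \sum_(i < k.+1) l i *
      (chain_mean l q k (N - k) i + x i / y k * chain_mean l p k (N - k) i).
    rewrite -[leLHS]yk; apply: ler_sum => i _; rewrite ler_pM2l//.
    rewrite -chain_mean_linear; apply: chain_mean_ge => //; first by rewrite -ltnS.
    move=> j; apply: le_trans ((pP j).2 _ _) _; first by rewrite divr_gt0.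
    by rewrite /q; lra.
  have E : \sum_(i < k.+1) l i *
      (chain_mean l q k (N - k) i + x i / y k * chain_mean l p k (N - k) i) =
      L k / L N * (\sum_(j < N.+1) l j * q j) +
      (y k)^-1 * \sum_(i < k.+1) l i * x i * chain_mean l p k (N - k) i.
    have := chain_mean_sum l_gt0 q k (N - k); rewrite kN => <-.
    rewrite mulr_sumr -big_split /=.
    by apply: eq_bigr => i _; ring.
  rewrite E in H.
  have K : 0 <= theta k * y k by rewrite mulr_ge0// ltW// theta_gt0.
  rewrite -subr_ge0; apply: le_trans (mulr_ge0 K H) _.
  have := Lambda_neq0 l_gt0 k; have := Lambda_neq0 l_gt0 N => H1 H2.
  have yk1 : y k != 0 by rewrite gt_eqF.
  rewrite le_eqVlt; apply/orP; left; apply/eqP; field.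
  by rewrite H1 H2 yk1.
(* The sum of the [l j * f (a j)] is dropped, being nonpositive. *)
have qP : L N / c * P <= - (\sum_(j < N.+1) l j * q j).
  have -> : \sum_(j < N.+1) l j * q j = \sum_(j < N.+1) l j * f (a j) - L N / c * P.
    rewrite /P mulr_sumr -sumrB; apply: eq_bigr => j _; rewrite /q /a.
    have := Lambda_neq0 l_gt0 j; have cn0 : c != 0 by rewrite gt_eqF.
    by move=> Hj; field; rewrite cn0 Hj.
  by move: aN; rewrite -/a; lra.
have : (\sum_(k < N.+1) l k * y k) * (- (\sum_(j < N.+1) l j * q j) / L N) <=
   P * \sum_(k < N.+1) l k * x k.
  rewrite mulr_suml; apply: le_trans (ler_sum _ (fun k _ => key k)) _.
  rewrite (chain_mean_occupation_sum l_gt0 p (fun i => l i * x i)) /P mulr_suml.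
  apply: ler_sum => j _; rewrite ler_wpM2l//.
    by rewrite mulr_ge0 ?(pP _).1// ltW// theta_gt0.
  rewrite (big_ord_widen N.+1 (fun i => l i * x i))//.
  rewrite [leRHS](bigID (fun i : 'I_N.+1 => (i < j.+1)%N))/= lerDl sumr_ge0// => i _.
  by rewrite mulr_ge0 ?ltW.
move=> H.
have Y0 : 0 <= \sum_(k < N.+1) l k * y k.
  by apply: sumr_ge0 => k _; rewrite mulr_ge0 ?ltW// (yP k).1.
have {}qP : P / c <= - (\sum_(j < N.+1) l j * q j) / L N.
  by rewrite ler_pdivlMr// (le_trans _ qP)//; lra.
have := le_trans (ler_wpM2l Y0 qP) H.
by rewrite mulrCA (ler_pM2l P0) ler_pdivrMr// mulrC.
Qed.

End hardy_upper_bound.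

(** * Existence of the mean, and necessary conditions for a Hardy bound *)

Section hardy_lower_bound.
Variables (R : realType) (f : R -> R) (l : R^nat).
Hypothesis f_chord : chord_concave [set x | 0 < x] f.
Hypothesis f_sign : forall x : R, 0 < x -> Num.sg (f x) = Num.sg (x - 1).
Hypothesis l_gt0 : forall n, 0 < l n.
Local Notation L := (Lambda l).
Local Notation theta n := (l n / L n).

(** Multiplied by [y], the equation becomes a sum of perspectives, concave in [y]; it is positive
    below all [x i] and negative above them. Hence a root exists and [xget] does not fall back on
    its default. *)
Lemma qdev_meanP (x : R^nat) n : (forall k, 0 < x k) ->
  let y := qdev_mean f (@first_terms R x n.+1) (@first_terms R l n.+1) in
  0 < y /\ \sum_(i < n.+1) l i * f (x i / y) = 0.
Proof.
move=> x0 y; rewrite /y /qdev_mean /first_terms.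
have exm : exists s, [set y : R | 0 < y /\ \sum_(i < n.+1) l i * f (x i / y) = 0] s.
  pose m := \sum_(i < n.+1) x i + 1.
  have xm (i : 'I_n.+1) : x i < m.
    rewrite /m (bigD1 i)//= -addrA ltrDl ltr_wpDl// sumr_ge0// => j _; exact: ltW.
  have xS0 : 0 < \sum_(i < n.+1) (x i)^-1.
    by rewrite big_ord_recl ltr_wpDr ?invr_gt0// sumr_ge0// => i _; rewrite invr_ge0 ltW.
  pose a := (2 * \sum_(i < n.+1) (x i)^-1)^-1.
  have a0 : 0 < a by rewrite invr_gt0 mulr_gt0.
  have ax (i : 'I_n.+1) : a < x i.
    rewrite -[x i]invrK /a ltf_pV2 ?posrE ?invr_gt0 ?mulr_gt0//.
    have : (x i)^-1 <= \sum_(i < n.+1) (x i)^-1.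
      rewrite [leRHS](bigD1 i)//= lerDl sumr_ge0// => j _; by rewrite invr_ge0 ltW.
    lra.
  pose g t := \sum_(i < n.+1) l i * (t * f (x i / t)).
  have gE t : g t = t * \sum_(i < n.+1) l i * f (x i / t).
    by rewrite mulr_sumr; apply: eq_bigr => i _; rewrite mulrCA.
  have am : a < m by apply: lt_trans (ax ord0) (xm ord0).
  have gc : chord_concave [set t | a <= t] g.
    move=> u v w /= au aw uv vw; rewrite /g !mulr_sumr -big_split/=.
    apply: ler_sum => i _.
    rewrite mulrCA [X in _ + X]mulrCA -mulrDr [leRHS]mulrCA ler_pM2l//.
    by apply: (dev_perspective f_chord f_sign) => //=; rewrite ltW//; lra.
  have ga : 0 < g a.
    apply: (@sum_ord_gt0 _ _ _ ord0) => [i|].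
      by rewrite !mulr_ge0 ?ltW// (dev_gt0 f_sign)// ltr_pdivlMr// mul1r.
    by rewrite !mulr_gt0// (dev_gt0 f_sign)// ltr_pdivlMr// mul1r.
  have gm : g m < 0.
    have m0 : 0 < m by lra.
    rewrite -oppr_gt0 /g -sumrN; apply: (@sum_ord_gt0 _ _ _ ord0) => [i|].
      rewrite oppr_ge0 !pmulr_rle0//.
      by rewrite ltW// (dev_lt0 f_sign) ?divr_gt0// ltr_pdivrMr// mul1r.
    by rewrite oppr_gt0 !pmulr_rlt0// (dev_lt0 f_sign) ?divr_gt0// ltr_pdivrMr// mul1r.
  have [s as_ gs] := chord_concave_root gc am ga gm.
  have s0 : 0 < s by lra.
  exists s; split => //; apply/eqP; move/eqP: gs.
  by rewrite gE mulf_eq0 gt_eqF.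
exact: (xgetPex 1 exm).
Qed.

Lemma qdev_mean_gt (x : R^nat) n (t : R) : (forall k, 0 < x k) -> 0 < t ->
  0 < \sum_(i < n.+1) l i * f (x i / t) ->
  t < qdev_mean f (@first_terms R x n.+1) (@first_terms R l n.+1).
Proof.
move=> x0 t0 H; have [] := qdev_meanP n x0.
set y := qdev_mean _ _ _ => y0 yE.
rewrite ltNge; apply/negP => yt; move: H; rewrite ltNge => /negP; apply.
rewrite -[leRHS]yE; apply: ler_sum => i _; rewrite ler_pM2l//.
rewrite (dev_mono f_chord f_sign) ?divr_gt0//.
by rewrite ler_pM2l// lef_pV2 ?posrE.
Qed.

Lemma Lambda_nd : nondecreasing_seq L.
Proof. by apply/nondecreasing_seqP => n; rewrite LambdaS lerDl ltW. Qed.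

Hypothesis L_dvg : L n @[n --> \oo] --> +oo.

Lemma Lambda_unbounded (A : R) n : exists2 m, (n <= m)%N & A <= L m.
Proof.
have /cvgryPge /(_ A) [m _ mP] := L_dvg.
by exists (maxn n m); [exact: leq_maxl | apply: mP; exact: leq_maxr].
Qed.

(* Abel-Dini: theta sums to at least 1/2 over each block doubling Lambda. *)
Lemma sum_theta_unbounded (A : R) : exists2 N, (0 < N)%N & A <= \sum_(k < N.+1) theta k.
Proof.
have t0 k : 0 <= theta k by rewrite ltW// theta_gt0.
have H n : exists N, n%:R / 2 <= \sum_(k < N.+1) theta k.
  elim: n => [|n [N IH]]; first by exists 0%N; rewrite mul0r sumr_ge0.
  have [M NM LM] := Lambda_unbounded (2 * L N) N.
  exists M; have : n%:R / 2 + 1 / 2 <= \sum_(k < M.+1) theta k; last by rewrite -natr1; lra.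
  rewrite -(big_mkord xpredT (fun k => theta k)) (big_cat_nat (n := N.+1))//=.
  rewrite big_mkord lerD//.
  apply: le_trans (_ : \sum_(N.+1 <= k < M.+1) l k / L M <= _).
    rewrite -mulr_suml ler_pdivlMr ?Lambda_gt0//.
    have : L M = L N + \sum_(N.+1 <= k < M.+1) l k.
      by rewrite /Lambda -!(big_mkord xpredT l) -big_cat_nat.
    lra.
  apply: ler_sum_nat => k /andP[_ kM].
  by rewrite ler_pM2l// lef_pV2 ?posrE ?Lambda_gt0// Lambda_nd.
have [n nA] : exists n, 2 * A <= n%:R.
  by exists (Num.trunc `|2 * A|).+1; rewrite ltW// (le_lt_trans (ler_norm _))// truncnS_gt.
have [N NP] := H n.
exists N.+1 => //; rewrite big_ord_recr /= ler_wpDr//; lra.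
Qed.

(** If the sums were positive from [K] on, the means at [K < k <= N] would exceed [b' / L k], and by
    Abel-Dini the left side of the Hardy inequality would outgrow the right, whose constant is only
    [b]. *)
Lemma hardy_bound_partial_sums (b b' : R) K :
  hardy_bound l (qdev_mean f) b%:E -> 0 <= b -> b < b' ->
  exists2 k, (K <= k)%N & \sum_(i < k.+1) l i * f (L k / (b' * L i)) <= 0.
Proof.
move=> hb b0 bb'; apply: contrapT => noK.
have L0 n : 0 < L n by apply: Lambda_gt0.
have pos k : (K <= k)%N -> 0 < \sum_(i < k.+1) l i * f (L k / (b' * L i)).
  by move=> Kk; rewrite ltNge; apply/negP => H; apply: noK; exists k.
have b'0 : 0 < b' by lra.
pose A n := \sum_(k < n.+1) theta k.
(* [T] collects the losses: the terms up to [K] on the left and the tail beyond [N] on the right.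
   The margin [A K + 1] in the choice of [N] forces [K <= N] and makes the final contradiction
   strict. *)
pose T := b' * A K + b / L 0.
have [N N0 NT] := sum_theta_unbounded (T / (b' - b) + A K + 1).
have KN : (K <= N)%N.
  rewrite leqNgt; apply/negP => NK.
  have : A N <= A K.
    rewrite /A (big_ord_widen K.+1 (fun k => theta k)); last exact: leqW.
    rewrite [leRHS](bigID (fun j : 'I_K.+1 => (j < N.+1)%N))/= lerDl.
    by rewrite sumr_ge0// => i _; rewrite ltW// theta_gt0.
  have : 0 <= T / (b' - b).
    rewrite divr_ge0//; last lra.
    rewrite addr_ge0 ?divr_ge0 ?mulr_ge0//; try exact: ltW.
    by rewrite /A sumr_ge0// => i _; rewrite ltW// theta_gt0.
  rewrite -/(A N) in NT; lra.
(* Beyond [N], [l n * x n = 1 / L n.-1 - 1 / L n], so the tail telescopes to at most [1 / L N] while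
   [x] stays positive. *)
pose x n := if (n <= N)%N then (L n)^-1 else (L n.-1 * L n)^-1.
have x0 n : 0 < x n by rewrite /x; case: ifP => _; rewrite invr_gt0// mulr_gt0.
have lx0 n : 0 <= l n * x n by rewrite mulr_ge0 ?ltW.
have tail m : \sum_(k < (N + m).+1) l k * x k = A N + (L N)^-1 - (L (N + m))^-1.
  elim: m => [|m IH].
    rewrite addn0 addrK; apply: eq_bigr => k _.
    by rewrite /x -ltnS ltn_ord.
  rewrite addnS big_ord_recr /= IH /x leqNgt ltnS leq_addr /=.
  have := L0 (N + m)%N; have := L0 (N + m).+1; rewrite LambdaS => H1 H2.
  by field; rewrite !gt_eqF.
have S1 : (\sum_(0 <= n <oo) (l n * x n)%:E <= (A N + (L N)^-1)%:E)%E.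
  apply: lime_le; first by apply: is_cvg_nneseries => n _ _; rewrite lee_fin.
  near=> n.
  have Nn : (N < n)%N by near: n; exact: nbhs_infty_gt.
  rewrite sumEFin lee_fin big_mkord.
  have -> : n = (N + (n - N.+1)).+1 by rewrite -addSn subnKC.
  by rewrite tail gerBl invr_ge0 ltW.
have S2 : ((b' * (A N - A K))%:E <= \sum_(0 <= n <oo)
   (l n * qdev_mean f (@first_terms R x n.+1) (@first_terms R l n.+1))%:E)%E.
  have y0 n : 0 < qdev_mean f (@first_terms R x n.+1) (@first_terms R l n.+1).
    by have [] := qdev_meanP n x0.
  apply: le_trans (nneseries_lim_ge N.+1 _); last first.
    by move=> n _ _; rewrite lee_fin mulr_ge0// ltW.
  rewrite sumEFin lee_fin.
  rewrite (big_cat_nat (n := K.+1))//= ler_wpDl//.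
    by rewrite sumr_ge0// => n _; rewrite mulr_ge0// ltW.
  have -> : A N - A K = \sum_(K.+1 <= k < N.+1) theta k.
    by rewrite /A -!(big_mkord xpredT (fun k => theta k)) (@big_cat_nat _ _ _ K.+1 0 N.+1)//= addrAC subrr add0r.
  rewrite mulr_sumr; apply: ler_sum_nat => k /andP[Kk kN].
  rewrite mulrCA ler_pM2l// ltW// qdev_mean_gt ?divr_gt0//.
  suff -> : \sum_(i < k.+1) l i * f (x i / (b' / L k)) =
      \sum_(i < k.+1) l i * f (L k / (b' * L i)) by apply: pos; exact: ltnW.
  apply: eq_bigr => i _; congr (_ * f _).
  have iN : (i <= N)%N by rewrite -ltnS; exact: leq_trans (ltn_ord i) kN.
  rewrite /x iN.
  by have := L0 i; have := L0 k => Hk Hi; field; rewrite !gt_eqF.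
have := le_trans S2 (le_trans (hb x x0) (lee_wpmul2l _ S1)).
rewrite lee_fin => /(_ b0); rewrite -EFinM lee_fin => H.
have bL : b / L N <= b / L 0.
  by rewrite ler_wpM2l// lef_pV2 ?posrE// Lambda_nd.
have : (b' - b) * (A N) <= T by rewrite /T; move: H; rewrite mulrDr; lra.
rewrite -ler_pdivlMl; last lra.
have AK0 : 0 <= A K by rewrite /A sumr_ge0// => i _; rewrite ltW// theta_gt0.
rewrite -/(A N) in NT; rewrite mulrC; lra.
Unshelve. all: by end_near.
Qed.

End hardy_lower_bound.

(** * The Hardy constant as a root *)

Section hardy_constant.
Variables (R : realType) (f : R -> R) (l : R^nat).
Hypothesis f_chord : chord_concave [set x | 0 < x] f.
Hypothesis f_sign : forall x : R, 0 < x -> Num.sg (f x) = Num.sg (x - 1).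
Hypothesis l_gt0 : forall n, 0 < l n.
Hypothesis theta_nincr : nonincreasing_seq (fun n => l n / Lambda l n).
Hypothesis L_dvg : Lambda l n @[n --> \oo] --> +oo.
Local Notation L := (Lambda l).

Let dev_sum (c : R) n := \sum_(j < n.+1) l j * f (L n / (c * L j)).

Lemma hardy_bound_of_sums (c : R) : 0 < c -> (forall n, dev_sum c n <= 0) ->
  hardy_bound l (qdev_mean f) c%:E.
Proof.
move=> c0 H x x0.
have yP n := qdev_meanP f_chord f_sign l_gt0 n x0.
apply: lime_le.
  by apply: is_cvg_nneseries => n _ _; rewrite lee_fin mulr_ge0 ?ltW// (yP n).1.
near=> n; have n0 : (0 < n)%N by near: n; exact: nbhs_infty_gt.
apply: le_trans (_ : (c * \sum_(i < n) l i * x i)%:E <= _)%E.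
  rewrite sumEFin lee_fin big_mkord -(prednK n0).
  exact: (hardy_partial_sums f_chord f_sign l_gt0 theta_nincr c0 x0 yP (H n.-1)).
rewrite EFinM lee_wpmul2l ?lee_fin ?(ltW c0)//.
rewrite -(big_mkord xpredT (fun i => l i * x i)) -sumEFin.
by apply: nneseries_lim_ge => k _ _; rewrite lee_fin mulr_ge0 ?ltW.
Unshelve. all: by end_near.
Qed.

Lemma hardy_bound_le (C D : \bar R) : (C <= D)%E ->
  hardy_bound l (qdev_mean f) C -> hardy_bound l (qdev_mean f) D.
Proof.
move=> CD hC x x0; apply: le_trans (hC x x0) _; apply: lee_wpmul2r => //.
by apply: nneseries_ge0 => n _ _; rewrite lee_fin mulr_ge0// ltW.
Qed.

(** [Psi] stands for the left side of the equation, integral or series. A root is a Hardy bound by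
    [up]; a smaller bound would, by [low], make [Psi] nonpositive somewhere below the root, where
    concavity makes it positive. *)
Lemma hardy_constant_root (Psi : R -> R) :
  chord_concave [set c | 1 <= c] (fun c => c * Psi c) ->
  (forall c, 0 < c -> c <= 1 -> 0 < Psi c) ->
  (exists2 m, 1 < m & Psi m < 0) ->
  (forall c, 0 < c -> Psi c = 0 -> forall n, dev_sum c n <= 0) ->
  (forall b b', 1 <= b -> b < b' ->
    (forall K, exists2 k, (K <= k)%N & dev_sum b k <= 0) -> Psi b' <= 0) ->
  exists2 c : R, is_hardy_constant l (qdev_mean f) c%:E &
    unique (fun c' => 0 < c' /\ Psi c' = 0) c.
Proof.
move=> Phi_concave Psi_pos [m m1 Psim] up low.
have Phi1 : 0 < 1 * Psi 1 by rewrite mul1r Psi_pos.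
have Phim : m * Psi m < 0 by rewrite pmulr_rlt0//; lra.
have [c c1 Phic] := chord_concave_root Phi_concave m1 Phi1 Phim.
have c0 : 0 < c by lra.
have {Phic} Psic : Psi c = 0 by move/eqP: Phic; rewrite mulf_eq0 gt_eqF// => /eqP.
have pos b d : 0 < b -> b < d -> Psi d = 0 -> 0 < Psi b.
  move=> b0 bd Psid; case: (leP b 1) => [b1|b1]; first exact: Psi_pos.
  have : 0 < b * Psi b.
    apply: (chord_concave_sign Phi_concave Phi1 (ltW b1) bd).
    by rewrite Psid mulr0.
  by rewrite pmulr_rgt0.
exists c; last first.
  split => // d [d0 Psid]; apply/eqP; rewrite eq_le !leNgt; apply/andP; split; apply/negP.
  - by move=> dc; have := pos _ _ d0 dc Psic; rewrite Psid ltxx.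
  - by move=> cd; have := pos _ _ c0 cd Psid; rewrite Psic ltxx.
split; first exact: hardy_bound_of_sums (up c c0 Psic).
move=> C hC; rewrite leNgt; apply/negP => Cc.
(* A smaller bound may lie below 1 or be minus infinity; it is raised to a real [b >= 1] still below
   [c]. *)
have [b /andP[b1 bc] Cb] : exists2 b : R, 1 <= b < c & (C <= b%:E)%E.
  case: C Cc {hC} => [C||] //=.
    rewrite lte_fin => Cc; exists (Num.max C 1); last by rewrite lee_fin le_max lexx.
    by rewrite le_max lexx orbT gt_max Cc c1.
  by move=> _; exists 1; rewrite ?leNye// lexx.
have hb := hardy_bound_le Cb hC.
(* The gap from [b] to [b1'] is spent on the partial sums, the gap from [b1'] to [b2] on [low], and
   [b2] is still below [c]. *)
pose b1' := b + (c - b) / 3; pose b2 := b + 2 * (c - b) / 3.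
have : Psi b2 <= 0.
  apply: (low b1'); rewrite /b1' /b2; try lra.
  by move=> K; apply: (hardy_bound_partial_sums f_chord f_sign l_gt0 L_dvg K hb); lra.
by rewrite leNgt (pos b2 c) /b2//; lra.
Qed.

End hardy_constant.

(** * Integrals over half-open intervals *)

Section half_open_integrals.
Variable R : realType.
Notation mu := (@lebesgue_measure R).
Implicit Types (a b k : R) (g h : R -> R).

Lemma nonincreasing_measurable (D : set R) g : is_interval D ->
  {in D &, {homo g : x y / x <= y >-> y <= x}} -> measurable_fun D g.
Proof.
move=> iD gD mD; apply: (measurability _ (RGenOInfty.measurableE R)) => //.
move=> _ [_ [r ->] <-]; apply: is_interval_measurable.
move=> x y /= [Dx gx] [Dy gy] z /andP[xz zy].
have Dz : D z by apply: (iD x y) => //; apply/andP.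
split=> //; move: gx gy; rewrite /= !in_itv/= !andbT => gx gy.
by apply: lt_le_trans gy _; apply: gD => //; exact: mem_set.
Qed.

Lemma integrable_oc_cst a b k : mu.-integrable `]a, b] (EFin \o cst k).
Proof.
apply: measurable_bounded_integrable => //=.
  by rewrite lebesgue_measure_itv/=; case: ifP => // _; rewrite -EFinB ltry.
by exists `|k|; split => // M kM x _ /=; exact: ltW.
Qed.

Lemma integrable_oc_bounded a b k m g : measurable_fun `]a, b] g ->
  (forall x, a < x -> x <= b -> k <= g x <= m) -> mu.-integrable `]a, b] (EFin \o g).
Proof.
move=> mg gb; apply: measurable_bounded_integrable => //=.
  by rewrite lebesgue_measure_itv/=; case: ifP => // _; rewrite -EFinB ltry.
exists (`|k| + `|m|); split => // M kM x /=; rewrite in_itv/= => /andP[ax xb].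
have /andP[kg gm] := gb _ ax xb.
rewrite ler_norml; apply/andP; split.
  have := ler_norm (- k); rewrite normrN; have := normr_ge0 m; lra.
have := ler_norm m; have := normr_ge0 k; lra.
Qed.

Lemma integrable_ocZ a b k g : mu.-integrable `]a, b] (EFin \o g) ->
  mu.-integrable `]a, b] (EFin \o (fun x => k * g x)).
Proof. exact: (@integrableZl _ _ R mu `]a, b] (measurable_itv _) k (EFin \o g)). Qed.

Lemma integrable_ocD a b g h : mu.-integrable `]a, b] (EFin \o g) ->
  mu.-integrable `]a, b] (EFin \o h) ->
  mu.-integrable `]a, b] (EFin \o (fun x => g x + h x)).
Proof.
exact: (@integrableD _ _ R mu `]a, b] (measurable_itv _) (EFin \o g) (EFin \o h)).
Qed.

Lemma integrable_oc_dominated a b k m g h : measurable_fun `]a, b] g ->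
  mu.-integrable `]a, b] (EFin \o h) ->
  (forall x, a < x -> x <= b -> `|g x| <= k * `|h x| + m) ->
  mu.-integrable `]a, b] (EFin \o g).
Proof.
move=> mg ih gh; pose u x := k * `|h x| + m.
have := @le_integrable _ _ R mu `]a, b] (measurable_itv _) (EFin \o g) (EFin \o u).
apply.
- exact/measurable_EFinP.
- move=> x /=; rewrite in_itv/= => /andP[ax xb]; rewrite lee_fin.
  exact: le_trans (gh _ ax xb) (ler_norm _).
- apply: integrable_ocD; last exact: integrable_oc_cst.
  exact/integrable_ocZ/integrable_norm.
Qed.

Lemma integrable_oc_sub a b a' b' g : a <= a' -> b' <= b ->
  mu.-integrable `]a, b] (EFin \o g) -> mu.-integrable `]a', b'] (EFin \o g).
Proof.
move=> aa bb; apply: integrableS => // x /=; rewrite !in_itv/= => /andP[ax xb].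
by rewrite (le_lt_trans aa ax) (le_trans xb bb).
Qed.

Lemma Rintegral_oc_split a c b g : a <= c -> c <= b ->
  mu.-integrable `]a, b] (EFin \o g) ->
  \int[mu]_(x in `]a, b]) g x = \int[mu]_(x in `]a, c]) g x + \int[mu]_(x in `]c, b]) g x.
Proof.
move=> ac cb ig; rewrite -(@Rintegral_itvB _ _ (BRight a) (BRight b) c) ?bnd_simp//.
by rewrite addrC subrK.
Qed.

Lemma Rintegral_oc_cst a b k : a <= b -> \int[mu]_(x in `]a, b]) k = k * (b - a).
Proof.
move=> ab; rewrite Rintegral_cst//= lebesgue_measure_itv/= lte_fin.
by case: ltP => //= ba; rewrite (le_anti (introT andP (conj ab ba))) subrr.
Qed.

Lemma Rintegral_oc_ge a b k g : a <= b -> mu.-integrable `]a, b] (EFin \o g) ->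
  (forall x, a < x -> x <= b -> k <= g x) -> k * (b - a) <= \int[mu]_(x in `]a, b]) g x.
Proof.
move=> ab ig kg; rewrite -Rintegral_oc_cst//; apply: le_Rintegral => //.
  exact: integrable_oc_cst.
by move=> x /=; rewrite in_itv/= => /andP[ax xb]; exact: kg.
Qed.

Lemma Rintegral_oc_le a b k g : a <= b -> mu.-integrable `]a, b] (EFin \o g) ->
  (forall x, a < x -> x <= b -> g x <= k) -> \int[mu]_(x in `]a, b]) g x <= k * (b - a).
Proof.
move=> ab ig kg; rewrite -Rintegral_oc_cst//; apply: le_Rintegral => //.
  exact: integrable_oc_cst.
by move=> x /=; rewrite in_itv/= => /andP[ax xb]; exact: kg.
Qed.

(** Monotone convergence along the intervals []b / n.+2, b]]; dividing by at least 2 keeps the left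
    end strictly below [b]. *)
Lemma ge0_integral_oc_le b (M : R) g : 0 < b -> measurable_fun `]0, b] g ->
  (forall x, 0 < x -> x <= b -> 0 <= g x) ->
  (forall d, 0 < d -> d < b -> (\int[mu]_(x in `]d, b]) (g x)%:E <= M%:E)%E) ->
  (\int[mu]_(x in `]0%R, b]) (g x)%:E <= M%:E)%E.
Proof.
move=> b0 mg g0 gM.
pose F (n : nat) := [set` `]b / n.+2%:R, b]].
have d0 n : 0 < b / n.+2%:R by rewrite divr_gt0.
have UF : [set` `]0, b]] = \bigcup_n F n.
  apply/seteqP; split => x.
    rewrite /= in_itv/= => /andP[x0 xb].
    exists (Num.trunc (b / x)).+1 => //; rewrite /F/= in_itv/= xb andbT.
    rewrite ltr_pdivrMr// mulrC -ltr_pdivrMr//.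
    by apply: lt_trans (truncnS_gt _) _; rewrite ltr_nat.
  by move=> [n _]; rewrite /F/= !in_itv/= => /andP[nx ->]; rewrite (lt_trans _ nx).
have H : (\int[mu]_(x in F i) (g x)%:E @[i --> \oo] --> \int[mu]_(x in `]0%R, b]) (g x)%:E)%E.
  rewrite UF; apply: ge0_nondecreasing_set_cvg_integral => [n m nm|n|n|n x].
  - apply/subsetPset => x; rewrite /F/= !in_itv/= => /andP[nx ->]; rewrite andbT.
    apply: le_lt_trans nx; rewrite ler_pM2l// lef_pV2 ?posrE//.
    by rewrite ler_nat.
  - exact: measurable_itv.
  - apply/measurable_EFinP; apply: measurable_funS mg => //.
    by rewrite UF; exact: bigcup_sup.
  - rewrite /F/= in_itv/= => /andP[nx xb]; rewrite lee_fin g0//.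
    exact: lt_trans nx.
rewrite -(cvg_lim _ H)//; apply: lime_le; first by apply/cvg_ex; eexists; exact: H.
near=> n; apply: gM => //; rewrite ltr_pdivrMr// ltr_pMr//.
by rewrite ltr1n.
Unshelve. all: by end_near.
Qed.

End half_open_integrals.

(** * The integral as a function of the constant *)

Section deviation_integral.
Variables (R : realType) (f : R -> R).
Hypothesis f_chord : chord_concave [set x | 0 < x] f.
Hypothesis f_sign : forall x : R, 0 < x -> Num.sg (f x) = Num.sg (x - 1).
Notation mu := (@lebesgue_measure R).
Local Notation h c := (fun x : R => f (c * x)^-1).
Local Notation f_integrable := (mu.-integrable `]0, 1] (EFin \o (fun x : R => f x^-1))).

Lemma dev_inv_nincr (x y : R) : 0 < x -> x <= y -> f y^-1 <= f x^-1.
Proof.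
move=> x0 xy; have y0 : 0 < y by lra.
by rewrite (dev_mono f_chord f_sign) ?invr_gt0// lef_pV2 ?posrE.
Qed.

Lemma dev_scaled_nincr (c d x y : R) : 0 < c -> 0 < x -> c <= d -> x <= y ->
  f (d * y)^-1 <= f (c * x)^-1.
Proof.
move=> c0 x0 cd xy; apply: dev_inv_nincr; first exact: mulr_gt0.
by apply: ler_pM => //; exact: ltW.
Qed.

Lemma dev_inv_ge0 (x : R) : 0 < x -> x <= 1 -> 0 <= f x^-1.
Proof.
by move=> x0 x1; apply: (dev_ge0 f_chord f_sign); rewrite invf_ge1.
Qed.

(** The upper bound is the dilation estimate: [b >= c^-1] brings [(c * x)^-1 / b] down to at most
    [x^-1], where [f] is nonnegative. *)
Lemma dev_scaled_bounds (c x : R) (b := Num.max 1 c^-1) : 0 < c -> 0 < x -> x <= 1 ->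
  f c^-1 <= f (c * x)^-1 <= 2 * b * f x^-1 + f (2 * b).
Proof.
move=> c0 x0 x1; have cx0 : 0 < c * x by rewrite mulr_gt0.
have b1 : 1 <= b by rewrite /b le_max lexx.
have b0 : 0 < b by lra.
apply/andP; split.
  by apply: dev_inv_nincr => //; rewrite ler_piMr// ltW.
apply: le_trans (dev_dilation f_chord f_sign b1 _) _; first by rewrite invr_gt0.
rewrite lerD2r ler_wpM2l//; first by rewrite mulr_ge0// ltW.
rewrite ge_max dev_inv_ge0// andbT (dev_mono f_chord f_sign)//.
  by rewrite divr_gt0// invr_gt0.
rewrite ler_pdivrMr// invfM mulrC ler_pM2l ?invr_gt0//.
by rewrite /b le_max lexx orbT.
Qed.

Lemma measurable_dev_scaled (c a b : R) : 0 < c -> 0 <= a ->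
  measurable_fun `]a, b] (h c).
Proof.
move=> c0 a0; apply: nonincreasing_measurable; first exact: interval_is_interval.
move=> x y; rewrite !inE/= !in_itv/= => /andP[ax xb] /andP[ay yb] xy.
by apply: dev_scaled_nincr => //; lra.
Qed.

Lemma integrable_dev_scaled (c : R) : 0 < c -> f_integrable ->
  mu.-integrable `]0, 1] (EFin \o h c).
Proof.
move=> c0 fi; set b := Num.max 1 c^-1.
have b1 : 1 <= b by rewrite /b le_max lexx.
apply: (@integrable_oc_dominated _ _ _ (2 * b) (f (2 * b) + `|f c^-1|) _ (fun x => f x^-1)) => //.
  exact: measurable_dev_scaled.
move=> x x0 x1; have /andP[lo hi] := dev_scaled_bounds c0 x0 x1.
have fx0 := dev_inv_ge0 x0 x1; rewrite (ger0_norm fx0).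
have : 0 <= 2 * b * f x^-1 by rewrite mulr_ge0//; lra.
have : 0 <= f (2 * b) by apply: (dev_ge0 f_chord f_sign); lra.
have := ler_norm (- f c^-1); rewrite normrN => H1 H2 H3.
have := normr_ge0 (f c^-1) => H4.
by rewrite ler_norml; apply/andP; split; move: hi; rewrite -/b => hi; lra.
Qed.

Lemma integrable_dev_unscaled (c : R) : 1 <= c ->
  mu.-integrable `]0, 1] (EFin \o h c) -> f_integrable.
Proof.
move=> c1 fi.
apply: (@integrable_oc_dominated _ _ _ (2 * c) (f (2 * c)) _ (h c)) => //.
  have := @measurable_dev_scaled 1 0 1 ltr01 (lexx _).
  by under [X in measurable_fun _ X]eq_fun do rewrite mul1r.
move=> x x0 x1; have fx0 := dev_inv_ge0 x0 x1; rewrite ger0_norm//.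
apply: le_trans (dev_dilation f_chord f_sign c1 _) _; first by rewrite invr_gt0.
rewrite lerD2r ler_wpM2l//; first by lra.
by rewrite ge_max normr_ge0 andbT -invfM mulrC ler_norm.
Qed.

Definition dev_integral (c : R) : R := \int[mu]_(x in `]0, 1]) f (c * x)^-1.

Section integrable.
Hypothesis fi : f_integrable.

(** [Rintegral] sends an infinite integral to 0, so integrability is what makes the real and the
    extended equation agree. *)
Lemma dev_integral_eq0 c : 0 < c -> hardy_equation f 0 c <-> dev_integral c = 0.
Proof.
move=> c0; rewrite /hardy_equation eqxx /dev_integral /Rintegral.
split=> [->//|H].
by rewrite -[LHS]fineK ?H//; apply: integrable_fin_num => //; exact: integrable_dev_scaled.
Qed.

(** For fixed [t], [c * f (t^-1 / c)] is a perspective of [f]; its chord inequality is integrated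
    over [t]. *)
Lemma dev_integral_chord : chord_concave [set c | 1 <= c] (fun c => c * dev_integral c).
Proof.
move=> x y z /= x1 z1 xy yz; rewrite /dev_integral.
have i c k : 0 < c -> mu.-integrable `]0, 1] (EFin \o (fun x => k * f (c * x)^-1)).
  by move=> c0; apply: integrable_ocZ; exact: integrable_dev_scaled.
rewrite !mulrA -!RintegralZl//; do ?[by apply: integrable_dev_scaled => //; lra].
rewrite -RintegralD//; do ?[by apply: i; lra].
apply: le_Rintegral => //; do ?[by apply: i; lra].
  by apply: integrable_ocD; apply: i; lra.
move=> t /=; rewrite in_itv/= => /andP[t0 t1].
have E c : (c * t)^-1 = t^-1 / c by rewrite invfM mulrC.
rewrite !E -!mulrA; apply: (dev_perspective f_chord f_sign) => //=; try lra.
by rewrite invr_gt0.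
Qed.

Lemma dev_integral_gt0 c : 0 < c -> c <= 1 -> 0 < dev_integral c.
Proof.
move=> c0 c1; rewrite /dev_integral.
have ic := integrable_dev_scaled c0 fi.
rewrite (@Rintegral_oc_split _ 0 (1 / 2) 1)//; try lra.
have i1 : mu.-integrable `]0, (1 / 2)] (EFin \o h c) by apply: integrable_oc_sub ic; lra.
have i2 : mu.-integrable `](1 / 2), 1] (EFin \o h c) by apply: integrable_oc_sub ic; lra.
have f2 : 0 < f 2 by apply: (dev_gt0 f_sign); lra.
have H1 : f 2 * (1 / 2 - 0) <= \int[mu]_(x in `]0, (1 / 2)]) f (c * x)^-1.
  apply: Rintegral_oc_ge => //.
  move=> x x0 x1; rewrite -[X in f X <= _](@invrK _ 2); apply: dev_inv_nincr.
    by rewrite mulr_gt0.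
  have : c * x <= 1 * x by rewrite ler_wpM2r// ltW.
  lra.
have H2 : 0 * (1 - 1 / 2) <= \int[mu]_(x in `](1 / 2), 1]) f (c * x)^-1.
  apply: Rintegral_oc_ge => //; first lra.
  move=> x x0 x1; apply: dev_inv_ge0; first by rewrite mulr_gt0//; lra.
  by apply: mulr_ile1 => //; lra.
lra.
Qed.

(** Little mass lies to the left of a small [d]; for [m = 2 / d] the integrand is at most
    [f 2^-1 < 0] on []d, 1]], which outweighs that mass. *)
Lemma dev_integral_lt0 : exists2 m, 1 < m & dev_integral m < 0.
Proof.
have f2 : f 2^-1 < 0 by apply: (dev_lt0 f_sign); lra.
have [e e0 eE] : exists2 e, 0 < e & e = - f 2^-1 / 2 by exists (- f 2^-1 / 2) => //; lra.
(* Otherwise every integral over []d, 1]] would fall short of the whole by at least [e], and so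
   would their limit. *)
have [d /andP[d0 d1] de] : exists2 d, 0 < d < 1 / 2 & \int[mu]_(x in `]0, d]) f x^-1 < e.
  apply: contrapT => H.
  have : (\int[mu]_(x in `]0%R, 1%R]) (f x^-1)%:E <=
      (\int[mu]_(x in `]0%R, 1%R]) f x^-1 - e)%R%:E)%E.
    apply: ge0_integral_oc_le => //.
    - have := @measurable_dev_scaled 1 0 1 ltr01 (lexx _).
      by under [X in measurable_fun _ X]eq_fun do rewrite mul1r.
    - by move=> x x0 x1; exact: dev_inv_ge0.
    - move=> d d0 d1.
      pose d' := Num.min d (1 / 4).
      have d'0 : 0 < d' by rewrite /d' lt_min d0; lra.
      have d'd : d' <= d by rewrite /d' ge_min lexx.
      have d'4 : d' <= 1 / 4 by rewrite /d' ge_min lexx orbT.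
      have id : mu.-integrable `]d, 1] (EFin \o (fun x => f x^-1)).
        by apply: integrable_oc_sub fi; lra.
      rewrite -[leLHS]fineK; last exact: integrable_fin_num.
      rewrite lee_fin -/(Rintegral mu `]d, 1] (fun x => f x^-1)).
      rewrite (@Rintegral_oc_split _ 0 d' 1)//; try lra.
      rewrite (@Rintegral_oc_split _ d' d 1)//; try lra; last first.
        by apply: integrable_oc_sub fi; lra.
      have : e <= \int[mu]_(x in `]0, d']) f x^-1.
        by rewrite leNgt; apply/negP => K; apply: H; exists d' => //; apply/andP; split; lra.
      have : 0 * (d - d') <= \int[mu]_(x in `]d', d]) f x^-1.
        apply: Rintegral_oc_ge => //; first by apply: integrable_oc_sub fi; lra.
        by move=> x x0 x1; apply: dev_inv_ge0; lra.
      have arith (A B C k w : R) : 0 * w <= C -> k <= B -> A <= B + (C + A) - k by lra.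
      exact: arith.
  rewrite -[leLHS]fineK; last exact: integrable_fin_num.
  by rewrite lee_fin -/(Rintegral mu `]0, 1] (fun x => f x^-1)) lerBrDr gerDl leNgt e0.
have m1 : 1 < 2 / d by rewrite ltr_pdivlMr//; lra.
exists (2 / d) => //; rewrite /dev_integral.
have m0 : 0 < 2 / d by lra.
have im := integrable_dev_scaled m0 fi.
rewrite (@Rintegral_oc_split _ 0 d 1)//; try lra.
have d1' : d <= 1 by lra.
have im1 : mu.-integrable `]0, d] (EFin \o h (2 / d)) by apply: integrable_oc_sub im.
have im2 : mu.-integrable `]d, 1] (EFin \o h (2 / d)).
  by apply: integrable_oc_sub im => //; exact: ltW.
have fi1 : mu.-integrable `]0, d] (EFin \o (fun x => f x^-1)) by apply: integrable_oc_sub fi.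
have arith (A B D : R) : D < e -> A <= D -> B <= f 2^-1 * (1 - d) -> A + B < 0.
  have : f 2^-1 * (1 - d) <= f 2^-1 * (1 / 2) by rewrite ler_nM2l//; lra.
  clear de im im1 im2 fi1; rewrite eE; lra.
apply: (arith _ _ _ de).
  apply: le_Rintegral => //.
  move=> x /=; rewrite in_itv/= => /andP[x0 xd]; apply: dev_inv_nincr => //.
  by rewrite ler_peMl// ltW.
apply: Rintegral_oc_le => //.
move=> x dx x1; apply: dev_inv_nincr => //.
by rewrite -mulrA ler_peMr// mulrC ler_pdivlMr// mul1r ltW.
Qed.

End integrable.
End deviation_integral.

(** * Comparison of the deviation sums with the integral *)

Section riemann_sums.
Variables (R : realType) (f : R -> R) (l : R^nat).
Hypothesis f_chord : chord_concave [set x | 0 < x] f.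
Hypothesis f_sign : forall x : R, 0 < x -> Num.sg (f x) = Num.sg (x - 1).
Hypothesis l_gt0 : forall n, 0 < l n.
Notation mu := (@lebesgue_measure R).
Local Notation L := (Lambda l).
Local Notation h c := (fun x : R => f (c * x)^-1).
Local Notation f_integrable := (mu.-integrable `]0, 1] (EFin \o (fun x : R => f x^-1))).

Let L0 n : 0 < L n. Proof. exact: Lambda_gt0. Qed.

Lemma dev_sum_node (c : R) n j : f (L n / (c * L j)) = f (c * (L j / L n))^-1.
Proof. by rewrite mulrA invf_div. Qed.

(** The nodes [L j / L n] are the right ends of the cells of a partition of []0, 1]], where the
    nonincreasing integrand is smallest on each cell. *)
Lemma dev_sum_le_integral (c : R) n : 0 < c -> f_integrable ->
  \sum_(j < n.+1) l j * f (L n / (c * L j)) <= L n * dev_integral f c.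
Proof.
move=> c0 fi; have ic := integrable_dev_scaled f_chord f_sign c0 fi.
suff H k : (k <= n)%N -> \sum_(j < k.+1) l j / L n * f (c * (L j / L n))^-1 <=
    \int[mu]_(x in `]0, L k / L n]) f (c * x)^-1.
  have := H n (leqnn n); rewrite divff ?Lambda_neq0// => {}H.
  rewrite mulrC -ler_pdivrMr// mulr_suml; apply: le_trans H.
  by apply: ler_sum => j _; rewrite dev_sum_node mulrAC.
have ule m : (m <= n)%N -> L m / L n <= 1.
  by move=> mn; rewrite ler_pdivrMr// mul1r Lambda_nd.
have iu a m : 0 <= a -> (m <= n)%N -> mu.-integrable `]a, (L m / L n)] (EFin \o h c).
  by move=> a0 mn; apply: integrable_oc_sub ic => //; exact: ule.
elim: k => [|k IH] kn.
  rewrite big_ord1 -Lambda0 mulrC -[X in _ * X]subr0.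
  apply: Rintegral_oc_ge => //; [by rewrite divr_ge0// ltW|exact: iu|].
  by move=> x x0 xu; apply: (dev_scaled_nincr f_chord f_sign).
have uk : L k / L n <= L k.+1 / L n by rewrite ler_pM2r ?invr_gt0// Lambda_nd.
have uk0 : 0 <= L k / L n by rewrite divr_ge0// ltW.
rewrite big_ord_recr /= (@Rintegral_oc_split _ 0 (L k / L n))//; last exact: iu.
apply: lerD; first exact: IH (ltnW kn).
have -> : l k.+1 / L n = L k.+1 / L n - L k / L n by rewrite LambdaS mulrDl addrAC subrr add0r.
rewrite mulrC; apply: Rintegral_oc_ge => //; first exact: iu.
by move=> x xk xu; apply: (dev_scaled_nincr f_chord f_sign) => //; exact: le_lt_trans xk.
Qed.

Lemma integrable_dev_tail (c d : R) : 0 < c -> 0 < d ->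
  mu.-integrable `]d, 1] (EFin \o h c).
Proof.
move=> c0 d0; apply: (@integrable_oc_bounded _ _ _ (f (c * 1)^-1) (f (c * d)^-1)).
  by apply: (measurable_dev_scaled f_chord f_sign) => //; exact: ltW.
move=> x dx x1; apply/andP; split; apply: (dev_scaled_nincr f_chord f_sign) => //.
  exact: lt_trans dx.
exact: ltW.
Qed.

Hypothesis L_dvg : L n @[n --> \oo] --> +oo.
Hypothesis theta_cvg0 : l n / L n @[n --> \oo] --> (0 : R).

(* Once theta is at most 1 - b/b', a node is at most b'/b times any point of the
   cell on its left. *)
Lemma dev_integral_tail_le0 (b b' d : R) : 1 <= b -> b < b' -> 0 < d -> d <= b'^-1 ->
  (forall K, exists2 k, (K <= k)%N & \sum_(i < k.+1) l i * f (L k / (b * L i)) <= 0) ->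
  \int[mu]_(x in `]d, 1]) f (b' * x)^-1 <= 0.
Proof.
move=> b1 bb' d0 db' inf; have b0 : 0 < b by lra.
have b'0 : 0 < b' by lra.
have [i0 thP] : exists i0, forall i, (i0 <= i)%N -> l i / L i <= 1 - b / b'.
  have e0 : 0 < 1 - b / b' by rewrite subr_gt0 ltr_pdivrMr// mul1r.
  have /cvgrPdist_lt /(_ _ e0) [i0 _ H] := theta_cvg0.
  exists i0 => i /H /=; rewrite sub0r normrN => /ltW; exact: le_trans (ler_norm _).
(* For such [k] the discarded cells up to [i0] lie to the left of [d]. *)
have [K Ki0 LK] := Lambda_unbounded L_dvg (L i0 / d) i0.
have [k Kk sk] := inf K.
have i0k : (i0 <= k)%N by apply: leq_trans Kk.
have u0 : 0 < L i0 / L k by rewrite divr_gt0.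
have ud : L i0 / L k <= d.
  rewrite ler_pdivrMr// -ler_pdivrMl// mulrC; apply: le_trans LK _; exact: Lambda_nd.
have iu a m : L i0 / L k <= a -> m <= 1 -> mu.-integrable `]a, m] (EFin \o h b').
  by move=> a0 m1; apply: integrable_oc_sub (integrable_dev_tail b'0 u0).
have d1 : d <= 1 by rewrite (le_trans db')// invf_le1//; lra.
have cell m : (i0 + m <= k)%N -> \int[mu]_(x in `]L i0 / L k, L (i0 + m) / L k]) f (b' * x)^-1 <=
    \sum_(i < m) l (i0 + i).+1 / L k * f (b * (L (i0 + i).+1 / L k))^-1.
  elim: m => [|m IH] mk.
    by rewrite addn0 big_ord0 set_itv_ge ?Rintegral_set0// bnd_simp ltxx.
  have mk' : (i0 + m <= k)%N by apply: leq_trans mk; rewrite addnS.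
  have um1 : L (i0 + m).+1 / L k <= 1 by rewrite ler_pdivrMr// mul1r Lambda_nd// -addnS.
  have um : L (i0 + m) / L k <= L (i0 + m).+1 / L k by rewrite ler_pM2r ?invr_gt0// Lambda_nd.
  have u0m : L i0 / L k <= L (i0 + m) / L k.
    by rewrite ler_pM2r ?invr_gt0// Lambda_nd// leq_addr.
  rewrite addnS big_ord_recr /= (@Rintegral_oc_split _ _ (L (i0 + m) / L k))//; last exact: iu.
  apply: lerD; first exact: IH.
  have -> : l (i0 + m).+1 / L k = L (i0 + m).+1 / L k - L (i0 + m) / L k.
    by rewrite LambdaS mulrDl addrAC subrr add0r.
  rewrite [leRHS]mulrC; apply: Rintegral_oc_le => //; first exact: iu.
  move=> x xm xu; apply: (dev_inv_nincr f_chord f_sign).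
    by rewrite mulr_gt0// divr_gt0.
  have x0 : 0 < x by apply: lt_trans xm; rewrite divr_gt0.
  apply: le_trans (_ : b' * (L (i0 + m) / L k) <= _); last by rewrite ler_pM2l// ltW.
  rewrite !mulrA ler_pM2r ?invr_gt0//.
  have := thP (i0 + m).+1 (leqW (leq_addr _ _)).
  rewrite ler_pdivrMr//.
  have -> : (1 - b / b') * L (i0 + m).+1 = L (i0 + m).+1 - b * L (i0 + m).+1 / b' by ring.
  rewrite LambdaS => H.
  by rewrite -ler_pdivrMl// mulrC; lra.
have uk : L k / L k = 1 by rewrite divff// Lambda_neq0.
have := cell (k - i0)%N; rewrite subnKC// uk => /(_ (leqnn _)).
rewrite (@Rintegral_oc_split _ _ d)//; last exact: iu.
set S := \sum_(i < _) _; set I1 := \int[mu]_(x in `]_, d]) _; set I2 := \int[mu]_(x in _) _.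
have I10 : 0 <= I1.
  have -> : 0 = 0 * (d - L i0 / L k) by rewrite mul0r.
  apply: Rintegral_oc_ge => //; first exact: iu.
  move=> x x0 xd; have xp : 0 < x := lt_trans u0 x0.
  apply: (dev_inv_ge0 f_chord f_sign); first by rewrite mulr_gt0.
  by rewrite -ler_pdivlMl// mulr1 (le_trans xd).
(* The discarded nodes are at most [d <= b'^-1 <= b^-1], so the discarded terms are nonnegative. *)
have S0 : S <= 0.
  have : \sum_(i < k.+1) l i / L k * f (b * (L i / L k))^-1 <= 0.
    rewrite -(pmulr_rle0 _ (L0 k)) mulr_sumr; apply: le_trans sk.
    rewrite le_eqVlt; apply/orP; left; apply/eqP; apply: eq_bigr => i _.
    by rewrite dev_sum_node; field; exact: Lambda_neq0.
  apply: le_trans.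
  rewrite -(big_mkord xpredT (fun i => l i / L k * f (b * (L i / L k))^-1)).
  rewrite (big_cat_nat (n := i0.+1))//= ler_wpDl//.
    rewrite big_mkord sumr_ge0// => i _; rewrite mulr_ge0//.
      by rewrite divr_ge0// ltW.
    apply: (dev_inv_ge0 f_chord f_sign); first by rewrite mulr_gt0// divr_gt0.
    have ui : L i / L k <= L i0 / L k by rewrite ler_pM2r ?invr_gt0// Lambda_nd// -ltnS.
    rewrite -ler_pdivlMl// mulr1 (le_trans ui)// (le_trans ud)// (le_trans db')//.
    by rewrite lef_pV2 ?posrE// ltW.
  rewrite -{1}(add0n i0.+1) big_addn subSS big_mkord /S.
  by apply: ler_sum => i _; rewrite addnS addnC.
lra.
Qed.

(** The integrand is nonnegative up to [a = b'^-1], so the uniform bound [- I2] for the integrals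
    over []d, a]] passes to []0, a]]; it yields both integrability and the sign. *)
Lemma dev_integral_le0 (b b' : R) : 1 <= b -> b < b' ->
  (forall K, exists2 k, (K <= k)%N & \sum_(i < k.+1) l i * f (L k / (b * L i)) <= 0) ->
  f_integrable /\ dev_integral f b' <= 0.
Proof.
move=> b1 bb' inf; have b0 : 0 < b by lra.
have b'1 : 1 < b' by lra.
have b'0 : 0 < b' by lra.
pose a := b'^-1; have a0 : 0 < a by rewrite invr_gt0.
have a1 : a <= 1 by rewrite invf_le1// ltW.
pose I2 := \int[mu]_(x in `]a, 1]) f (b' * x)^-1.
have h0 x : 0 < x -> x <= a -> 0 <= f (b' * x)^-1.
  move=> x0 xa; apply: (dev_inv_ge0 f_chord f_sign); first by rewrite mulr_gt0.
  by rewrite -ler_pdivlMl// mulr1.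
have mh (c : R) : measurable_fun `]0, c] (h b') by exact: (measurable_dev_scaled f_chord f_sign).
have I1 : (\int[mu]_(x in `]0%R, a]) (f (b' * x)^-1)%:E <= (- I2)%:E)%E.
  apply: ge0_integral_oc_le => // d d0 da.
  have id : mu.-integrable `]d, 1] (EFin \o h b') by exact: integrable_dev_tail.
  have ida : mu.-integrable `]d, a] (EFin \o h b') by apply: integrable_oc_sub id.
  rewrite -[leLHS]fineK; last exact: integrable_fin_num.
  rewrite lee_fin -[leLHS]/(\int[mu]_(x in `]d, a]) f (b' * x)^-1).
  have := dev_integral_tail_le0 b1 bb' d0 (ltW da) inf.
  rewrite (@Rintegral_oc_split _ _ a)//; last exact: ltW.
  by rewrite -/I2 => H; rewrite -[leRHS]sub0r lerBrDr.
have i1 : mu.-integrable `]0, a] (EFin \o h b').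
  apply/integrableP; split; first by apply/measurable_EFinP; exact: mh.
  under eq_integral => x.
    rewrite inE/= in_itv/= => /andP[x0 xa].
    rewrite ger0_norm; last by rewrite h0.
    over.
  by rewrite (le_lt_trans I1)// ltry.
have ia : mu.-integrable `]0, 1] (EFin \o h b').
  apply/integrableP; split; first by apply/measurable_EFinP; exact: mh.
  have UE : `]0, 1]%classic = (`]0, a] `|` `]a, 1])%classic :> set R.
    by rewrite -itv_bndbnd_setU// bnd_simp// ltW.
  rewrite UE ge0_integral_setU//=.
  - apply: lte_add_pinfty; first by have /integrableP[] := i1.
    by have /integrableP[] := integrable_dev_tail b'0 a0.
  - by rewrite -UE; apply/measurable_EFinP; apply: measurableT_comp => //; exact: mh.
  - apply/eqP/seteqP; split => x //= [].
    by rewrite !in_itv/= => /andP[_ xa] /andP[ax _]; have := lt_le_trans ax xa; rewrite ltxx.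
split; first exact: (integrable_dev_unscaled f_chord f_sign (ltW b'1) ia).
rewrite /dev_integral (@Rintegral_oc_split _ _ a)//; last exact: ltW.
rewrite -/I2 -lerBrDr sub0r -lee_fin.
rewrite fineK//; exact: integrable_fin_num.
Qed.

End riemann_sums.

(** * Convergence of the geometric series and integrability *)

Section deviation_series.
Variables (R : realType) (f : R -> R) (q : R).
Hypothesis f_chord : chord_concave [set x | 0 < x] f.
Hypothesis f_sign : forall x : R, 0 < x -> Num.sg (f x) = Num.sg (x - 1).
Hypotheses (q0 : 0 < q) (q1 : q < 1).
Notation mu := (@lebesgue_measure R).
Local Notation f_integrable := (mu.-integrable `]0, 1] (EFin \o (fun x : R => f x^-1))).

Let q_onem : 0 < 1 - q. Proof. by rewrite subr_gt0. Qed.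

Definition dev_psum (c : R) (n : nat) : R := \sum_(k < n) q ^+ k * f (c * q ^+ k)^-1.

Definition dev_series (c : R) : R := limn (dev_psum c).

Let qX0 k : 0 < q ^+ k. Proof. exact: exprn_gt0. Qed.

Let qX1 k : q ^+ k <= 1. Proof. by rewrite exprn_ile1// ltW. Qed.

Let qXle k m : (k <= m)%N -> q ^+ m <= q ^+ k.
Proof. by move=> km; rewrite ler_wiXn2l// ltW. Qed.

Lemma geometric_psum_le n : \sum_(k < n) q ^+ k <= (1 - q)^-1.
Proof.
rewrite -[leRHS]mul1r ler_pdivlMr//.
have : (1 - q) * \sum_(k < n) q ^+ k = 1 - q ^+ n by rewrite -[RHS]opprB subrX1 -mulNr opprB.
by rewrite mulrC => ->; rewrite gerBl ltW.
Qed.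

Lemma expr_small (e : R) : 0 < e -> exists n, forall m, (n <= m)%N -> q ^+ m < e.
Proof.
move=> e0; have : `|q| < 1 by rewrite ger0_norm// ltW.
move=> /cvg_expr /cvgrPdist_lt /(_ _ e0) [n _ H]; exists n => m /H /=.
by rewrite sub0r normrN ger0_norm// ltW.
Qed.

Lemma dev_term_ge (c : R) k : 0 < c -> - `|f c^-1| <= f (c * q ^+ k)^-1.
Proof.
move=> c0; have /andP[lo _] := dev_scaled_bounds f_chord f_sign c0 (qX0 k) (qX1 k).
by apply: le_trans lo; rewrite lerNl -normrN ler_norm.
Qed.

(** The terms are at least [- e * q ^+ k], so adding a geometric series makes the partial sums
    nondecreasing. *)
Lemma cvg_dev_psum (c M : R) : 0 < c -> (forall n, dev_psum c n <= M) ->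
  cvgn (dev_psum c).
Proof.
move=> c0 PM; set e := `|f c^-1|.
pose A n := \sum_(k < n) q ^+ k * (f (c * q ^+ k)^-1 + e).
have PE : dev_psum c = A - (e *: (series (geometric 1 q))).
  apply/funext => n; rewrite seriesEord /A /dev_psum !fctE /GRing.scale/= mulr_sumr -sumrB.
  by apply: eq_bigr => k _ /=; rewrite mul1r; ring.
rewrite PE; apply: is_cvgB; last first.
  by apply: is_cvgZr; apply: is_cvg_geometric_series; rewrite ger0_norm// ltW.
apply: nondecreasing_is_cvgn.
  apply/nondecreasing_seqP => n; rewrite /A big_ord_recr/= lerDl mulr_ge0//.
    exact: ltW.
  by have := dev_term_ge n c0; rewrite -/e; lra.
exists (M + e * (1 - q)^-1) => _ [n _ <-].
have -> : A n = dev_psum c n + e * \sum_(k < n) q ^+ k.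
  rewrite /A /dev_psum mulr_sumr -big_split/=; apply: eq_bigr => k _; ring.
by rewrite lerD// ler_wpM2l ?normr_ge0 ?geometric_psum_le.
Qed.

Lemma dev_psum1_nd : nondecreasing_seq (dev_psum 1).
Proof.
apply/nondecreasing_seqP => n; rewrite /dev_psum big_ord_recr/= lerDl.
by rewrite mulr_ge0 ?(ltW (qX0 n))// mul1r (dev_inv_ge0 f_chord f_sign).
Qed.

Lemma cvg_dev_psum_scaled (c : R) : 0 < c -> cvgn (dev_psum 1) -> cvgn (dev_psum c).
Proof.
move=> c0 c1; set b := Num.max 1 c^-1.
have b1 : 1 <= b by rewrite /b le_max lexx.
have f2b : 0 <= f (2 * b) by apply: (dev_ge0 f_chord f_sign); lra.
apply: (@cvg_dev_psum _ (2 * b * dev_series 1 + f (2 * b) * (1 - q)^-1)) => // n.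
apply: le_trans (_ : 2 * b * dev_psum 1 n + f (2 * b) * \sum_(k < n) q ^+ k <= _); last first.
  apply: lerD; last by apply: ler_wpM2l => //; exact: geometric_psum_le.
  rewrite ler_wpM2l//; first lra.
  exact: (nondecreasing_cvgn_le dev_psum1_nd c1).
rewrite /dev_psum !mulr_sumr -big_split/=; apply: ler_sum => k _.
have /andP[_ hi] := dev_scaled_bounds f_chord f_sign c0 (qX0 k) (qX1 k).
rewrite mul1r; apply: le_trans (ler_wpM2l (ltW (qX0 k)) hi) _.
by rewrite -/b le_eqVlt; apply/orP; left; apply/eqP; ring.
Qed.

(** Integral test on the cells []q ^+ n.+1, q ^+ n]], of length [(1 - q) * q ^+ n]: the value at the
    right end is a lower bound. *)
Lemma integrable_cvg_dev_psum : f_integrable -> cvgn (dev_psum 1).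
Proof.
move=> fi.
have fi' a b : 0 <= a -> b <= 1 -> mu.-integrable `]a, b] (EFin \o (fun x => f x^-1)).
  by move=> a0 b1; apply: integrable_oc_sub fi.
have H n : (1 - q) * dev_psum 1 n <= \int[mu]_(x in `]q ^+ n, 1]) f x^-1.
  elim: n => [|n IH].
    by rewrite /dev_psum big_ord0 mulr0 expr0 set_itv_ge ?Rintegral_set0// bnd_simp ltxx.
  rewrite (@Rintegral_oc_split _ _ (q ^+ n) 1)//; first last.
  - by apply: fi' => //; exact: ltW.
  - exact: qXle.
  rewrite /dev_psum big_ord_recr/= mulrDr addrC; apply: lerD => //.
  have -> : (1 - q) * (q ^+ n * f (1 * q ^+ n)^-1) = f (q ^+ n)^-1 * (q ^+ n - q ^+ n.+1).
    by rewrite exprS mul1r; ring.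
  apply: Rintegral_oc_ge; [exact: qXle|apply: fi' => //; exact: ltW|].
  move=> x xn xq; apply: (dev_inv_nincr f_chord f_sign) => //; exact: lt_trans xn.
apply: (@cvg_dev_psum _ ((1 - q)^-1 * \int[mu]_(x in `]0, 1]) f x^-1)) => // n.
rewrite ler_pdivlMl//.
apply: le_trans (H n) _; rewrite (@Rintegral_oc_split _ 0 (q ^+ n) 1)//; last exact: ltW.
rewrite lerDr -[leLHS](mul0r (q ^+ n - 0)); apply: Rintegral_oc_ge; first exact: ltW.
  exact: fi'.
by move=> x x0 x1; apply: (dev_inv_ge0 f_chord f_sign) => //; apply: le_trans (qX1 n).
Qed.

(** On the same cells the value at the left end is an upper bound; the cell length is [(1 - q) / q]
    times its weight [q ^+ n.+1], whence the factor and the shifted index. *)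
Lemma cvg_dev_psum_integrable : cvgn (dev_psum 1) -> f_integrable.
Proof.
move=> cv.
have i1 n : mu.-integrable `](q ^+ n), 1] (EFin \o (fun x => f x^-1)).
  have := integrable_dev_tail f_chord f_sign ltr01 (qX0 n).
  by under [X in EFin \o X]eq_fun do rewrite mul1r.
have H n : \int[mu]_(x in `]q ^+ n, 1]) f x^-1 <= (1 - q) / q * dev_psum 1 n.+1.
  elim: n => [|n IH].
    rewrite expr0 set_itv_ge ?Rintegral_set0 ?bnd_simp ?ltxx//.
    rewrite /dev_psum big_ord1 expr0 !mul1r mulr_ge0//; first by rewrite divr_ge0// ltW.
    by apply: (dev_inv_ge0 f_chord f_sign).
  rewrite (@Rintegral_oc_split _ _ (q ^+ n) 1)//; last exact: qXle.
  rewrite /dev_psum big_ord_recr/= mulrDr addrC; apply: lerD => //.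
  have -> : (1 - q) / q * (q ^+ n.+1 * f (1 * q ^+ n.+1)^-1) =
      f (q ^+ n.+1)^-1 * (q ^+ n - q ^+ n.+1).
    by rewrite exprS mul1r; field; rewrite gt_eqF.
  apply: Rintegral_oc_le; [exact: qXle|exact: (integrable_oc_sub _ _ (i1 n.+1))|].
  by move=> x xn xq; apply: (dev_inv_nincr f_chord f_sign) => //; exact: ltW.
have mf : measurable_fun `](0 : R), (1 : R)] (fun x => f x^-1).
  have := @measurable_dev_scaled _ _ f_chord f_sign 1 0 1 ltr01 (lexx _).
  by under [X in measurable_fun _ X]eq_fun do rewrite mul1r.
have f0 x : 0 < x -> x <= 1 -> 0 <= f x^-1 by exact: (dev_inv_ge0 f_chord f_sign).
have I1 : (\int[mu]_(x in `]0%R, 1%R]) (f x^-1)%:E <= ((1 - q) / q * dev_series 1)%:E)%E.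
  apply: ge0_integral_oc_le => // d d0 d1.
  have [n qn] := expr_small d0.
  have qd : q ^+ n <= d by rewrite ltW// qn.
  have id : mu.-integrable `]d, 1] (EFin \o (fun x => f x^-1)).
    exact: (integrable_oc_sub _ _ (i1 n)).
  rewrite -[leLHS]fineK; last exact: integrable_fin_num.
  rewrite lee_fin -[leLHS]/(\int[mu]_(x in `]d, 1]) f x^-1).
  apply: le_trans (_ : (1 - q) / q * dev_psum 1 n.+1 <= _); last first.
    rewrite ler_wpM2l//; first by rewrite divr_ge0// ltW.
    exact: (nondecreasing_cvgn_le dev_psum1_nd cv).
  apply: le_trans (H n); rewrite (@Rintegral_oc_split _ (q ^+ n) d 1)//; last exact: ltW.
  rewrite lerDr -[leLHS](mul0r (d - q ^+ n)); apply: Rintegral_oc_ge => //.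
    by apply: (integrable_oc_sub _ _ (i1 n)) => //; exact: ltW.
  by move=> x xn xd; apply: f0; [exact: lt_trans xn|apply: le_trans xd _; exact: ltW].
apply/integrableP; split; first exact/measurable_EFinP.
under eq_integral => x.
  rewrite inE/= in_itv/= => /andP[x0 x1].
  rewrite ger0_norm; last by rewrite f0.
  over.
by rewrite (le_lt_trans I1)// ltry.
Qed.

End deviation_series.

(** * Concavity, functional equation and sign of the series *)

Section deviation_series_sign.
Variables (R : realType) (f : R -> R) (q : R).
Hypothesis f_chord : chord_concave [set x | 0 < x] f.
Hypothesis f_sign : forall x : R, 0 < x -> Num.sg (f x) = Num.sg (x - 1).
Hypotheses (q0 : 0 < q) (q1 : q < 1).
Local Notation P := (dev_psum f q).
Local Notation S := (dev_series f q).

Let qX0 k : 0 < q ^+ k. Proof. exact: exprn_gt0. Qed.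

Let qX1 k : q ^+ k <= 1. Proof. by rewrite exprn_ile1// ltW. Qed.

Let q_onem : 0 < 1 - q. Proof. by rewrite subr_gt0. Qed.

Hypothesis cvg1 : cvgn (P 1).

Lemma dev_series_cvg c : 0 < c -> P c @ \oo --> S c.
Proof. by move=> c0; exact: cvg_dev_psum_scaled. Qed.

Lemma dev_series_eq0 eta c : eta != 0 -> q = 1 - eta -> 0 < c ->
  hardy_equation f eta c <-> S c = 0.
Proof.
move=> eta0 qE c0; rewrite /hardy_equation (negbTE eta0) -qE.
have -> : series (fun k => q ^+ k * f (c * q ^+ k)^-1) = P c by rewrite seriesEord.
split=> [H|<-]; last exact: dev_series_cvg.
exact: (cvg_lim _ H).
Qed.

Lemma dev_series_nincr c d : 0 < c -> c <= d -> S d <= S c.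
Proof.
move=> c0 cd; apply: (ler_cvg_to (dev_series_cvg (lt_le_trans c0 cd)) (dev_series_cvg c0)).
apply: nearW => n; apply: ler_sum => k _; rewrite ler_pM2l//.
exact: (dev_scaled_nincr f_chord f_sign).
Qed.

(** Termwise concavity of perspectives, in the limit. The domain is all of [0 < c] because
    [dev_series_step] uses points below 1. *)
Lemma dev_series_chord : chord_concave [set c | 0 < c] (fun c => c * S c).
Proof.
move=> x y z /= x0 z0 xy yz; have y0 : 0 < y by lra.
have cv c k : 0 < c -> k * (c * P c n) @[n --> \oo] --> k * (c * S c).
  by move=> c0; do 2 apply: cvgMr; exact: dev_series_cvg.
apply: (ler_cvg_to (cvgD (cv _ (z - y) x0) (cv _ (y - x) z0)) (cv _ (z - x) y0)).
apply: nearW => n; rewrite !fctE /dev_psum !mulr_sumr -big_split/=; apply: ler_sum => k _.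
have E c : (c * q ^+ k)^-1 = (q ^+ k)^-1 / c by rewrite invfM mulrC.
have F (a c w : R) : a * (c * (q ^+ k * w)) = q ^+ k * (a * (c * w)) by ring.
rewrite !E !F -mulrDr ler_pM2l//.
by apply: (dev_perspective f_chord f_sign) => //=; rewrite ?invr_gt0 ?ltW.
Qed.

Lemma dev_series_ge c : 0 < c -> f c^-1 <= (1 - q) * S c.
Proof.
move=> c0; rewrite -ler_pdivrMl// mulrC.
have cg : f c^-1 * series (geometric 1 q) n @[n --> \oo] --> f c^-1 * (1 / (1 - q)).
  by apply: cvgMr; apply: cvg_geometric_series; rewrite ger0_norm// ltW.
rewrite -[X in _ * X]mul1r; apply: (ler_cvg_to cg (dev_series_cvg c0)).
apply: nearW => n; rewrite seriesEord/= mulr_sumr; apply: ler_sum => k _.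
rewrite mul1r mulrC ler_pM2l//; apply: (dev_inv_nincr f_chord f_sign).
  exact: mulr_gt0.
by rewrite ler_piMr// ltW.
Qed.

Lemma dev_psumS c n : P c n.+1 = f c^-1 + q * P (c * q) n.
Proof.
rewrite /dev_psum big_ord_recl expr0 mul1r mulr1 mulr_sumr; congr (_ + _).
by apply: eq_bigr => k _; rewrite /= /bump/= add1n exprS !mulrA.
Qed.

Lemma dev_series_rec c : 0 < c -> S c = f c^-1 + q * S (c * q).
Proof.
move=> c0; have cq0 : 0 < c * q by exact: mulr_gt0.
have H : P c n.+1 @[n --> \oo] --> S c by rewrite (cvg_shiftS (P c)); exact: dev_series_cvg.
have H' : f c^-1 + q * P (c * q) n @[n --> \oo] --> f c^-1 + q * S (c * q).
  by apply: cvgD; [exact: cvg_cst|apply: cvgMr; exact: dev_series_cvg].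
have E : (fun n => P c n.+1) = (fun n => f c^-1 + q * P (c * q) n).
  by apply/funext => n; exact: dev_psumS.
by rewrite E in H; exact: (cvg_unique _ H H').
Qed.

(** The first term may vanish, at [c = 1]; strict positivity comes from the remaining terms,
    rescaled to [c * q < 1]. *)
Lemma dev_series_gt0 c : 0 < c -> c <= 1 -> 0 < S c.
Proof.
move=> c0 c1; have cq0 : 0 < c * q by exact: mulr_gt0.
rewrite dev_series_rec// ltr_wpDl ?(dev_inv_ge0 f_chord f_sign)// pmulr_rgt0//.
rewrite -(pmulr_rgt0 _ q_onem); apply: lt_le_trans (dev_series_ge cq0).
apply: (dev_gt0 f_sign); rewrite invf_gt1//.
by apply: le_lt_trans q1; rewrite ler_piMl// ltW.
Qed.

Lemma dev_series_lt0 : exists2 m, 1 < m & S m < 0.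
Proof.
have fq : f q < 0 by exact: (dev_lt0 f_sign).
(* Iterating the functional equation from [q ^- m.+1] down to 1 collects negative values of [f], of
   which one [f q] is kept, while the contribution of [S 1] decays. *)
have H m : S (q ^- m.+1) <= f q + q ^+ m.+1 * S 1.
  elim: m => [|m IH].
    rewrite dev_series_rec ?invr_gt0// invrK expr1 mulVf ?gt_eqF//.
  rewrite dev_series_rec ?invr_gt0// invrK.
  have -> : q ^- m.+2 * q = q ^- m.+1.
    by rewrite exprS invfM mulrAC mulVf ?mul1r// gt_eqF.
  have : f (q ^+ m.+2) <= f q.
    by apply: (dev_mono f_chord f_sign) => //; rewrite exprS ler_piMr// ltW.
  have : q * S (q ^- m.+1) <= q * (f q + q ^+ m.+1 * S 1) by rewrite ler_pM2l.
  have : q * f q < 0 by rewrite pmulr_rlt0.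
  by rewrite (exprS _ m.+1) mulrDr -mulrA; lra.
have S1 : 0 < S 1 by exact: dev_series_gt0.
have e0 : 0 < - f q / S 1 by rewrite divr_gt0// oppr_gt0.
have [n nP] := expr_small q0 q1 e0.
exists (q ^- n.+1).
  by rewrite invf_gt1// exprS; apply: le_lt_trans q1; rewrite ler_piMr// ltW.
apply: le_lt_trans (H n) _.
have := nP n.+1 (leqnSn n); rewrite ltr_pdivlMr//; lra.
Qed.

End deviation_series_sign.

Lemma cvg_sum_ord (R : realType) n (u : nat -> R^nat) (v : R^nat) :
  (forall m, u m k @[k --> \oo] --> v m) ->
  \sum_(m < n) u m k @[k --> \oo] --> \sum_(m < n) v m.
Proof.
move=> uv; elim: n => [|n IH].
  rewrite big_ord0; have -> : (fun k => \sum_(m < 0) u m k) = cst 0.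
    by apply/funext => k; rewrite big_ord0.
  exact: cvg_cst.
rewrite big_ord_recr; have -> : (fun k => \sum_(m < n.+1) u m k) =
    (fun k => \sum_(m < n) u m k + u n k).
  by apply/funext => k; rewrite big_ord_recr.
exact: cvgD IH (uv n).
Qed.

(** * Comparison of the deviation sums with the series *)

Section hardy_series.
Variables (R : realType) (f : R -> R) (l : R^nat) (q : R).
Hypothesis f_chord : chord_concave [set x | 0 < x] f.
Hypothesis f_sign : forall x : R, 0 < x -> Num.sg (f x) = Num.sg (x - 1).
Hypotheses (q0 : 0 < q) (q1 : q < 1).
Hypothesis l_gt0 : forall n, 0 < l n.
Local Notation L := (Lambda l).
Local Notation theta n := (l n / L n).
Hypothesis theta_nincr : nonincreasing_seq (fun n => l n / L n).
Hypothesis theta_cvg : l n / L n @[n --> \oo] --> 1 - q.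
Local Notation P := (dev_psum f q).
Local Notation S := (dev_series f q).

Let L0 n : 0 < L n. Proof. exact: Lambda_gt0. Qed.

Let qX0 k : 0 < q ^+ k. Proof. exact: exprn_gt0. Qed.

Let q_onem : 0 < 1 - q. Proof. by rewrite subr_gt0. Qed.

Lemma theta_ge n : 1 - q <= theta n.
Proof.
rewrite -(cvg_lim (@Rhausdorff R) theta_cvg).
by apply: nonincreasing_cvgn_ge => //; apply/cvg_ex; exists (1 - q).
Qed.

Lemma Lambda_ratio_le n : L n <= q * L n.+1.
Proof.
have := theta_ge n.+1; rewrite lerBlDr -lerBlDl theta_onem//.
by rewrite ler_pdivrMr.
Qed.

(** For [d = q * c] this is the functional equation; for smaller [d], concavity of [c * S c] at
    [d < q * c < c] is added. An arbitrary step is thus compared with a geometric one. *)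
Lemma dev_series_step c d : cvgn (P 1) -> 0 < d -> d <= q * c -> 0 < c ->
  (c - d) * f c^-1 + (1 - q) * (d * S d) <= (1 - q) * (c * S c).
Proof.
move=> cv d0 dc c0.
have rec := dev_series_rec f_chord f_sign q0 q1 cv c0.
have qc0 : 0 < c * q by rewrite mulr_gt0.
have key : (c - d) * f c^-1 + (1 - q) * (d * S d) <=
    (1 - q) * c * f c^-1 + (1 - q) * (c * q * S (c * q)).
  move: dc; rewrite le_eqVlt mulrC => /predU1P[->|dc].
    by rewrite le_eqVlt; apply/orP; left; apply/eqP; ring.
  have qcc : c * q < c by rewrite gtr_pMr.
  have := dev_series_chord f_chord f_sign q0 q1 cv d0 c0 dc qcc => /=.
  rewrite rec => H.
  have : c * ((1 - q) * (d * S d) + (c * q - d) * f c^-1) <= c * ((1 - q) * (c * q * S (c * q))).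
    lra.
  by rewrite ler_pM2l//; lra.
by apply: le_trans key _; rewrite [in leRHS]rec le_eqVlt; apply/orP; left; apply/eqP; ring.
Qed.

Lemma dev_sum_le_series c n : cvgn (P 1) -> 0 < c ->
  \sum_(j < n.+1) l j * f (L n / (c * L j)) <= L n * (1 - q) * S c.
Proof.
move=> cv c0; pose t m := c * (L m / L n).
have t0 m : 0 < t m by rewrite mulr_gt0// divr_gt0.
(* With [(1 - q) * (t * S t)] in the role of the integral over []0, t]], cells are added one at a
   time. *)
suff H m : \sum_(j < m.+1) c * l j / L n * f (t j)^-1 <= (1 - q) * (t m * S (t m)).
  have := H n; rewrite {2 3}/t divff ?Lambda_neq0// mulr1.
  rewrite -(ler_pM2l (L0 n)) -(ler_pM2l (_ : 0 < c^-1)) ?invr_gt0//.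
  have cn0 : c != 0 by rewrite gt_eqF.
  have -> : c^-1 * (L n * ((1 - q) * (c * S c))) = L n * (1 - q) * S c by field.
  apply: le_trans; rewrite !mulr_sumr le_eqVlt; apply/orP; left; apply/eqP.
  apply: eq_bigr => j _; rewrite dev_sum_node -/(t j).
  by have := Lambda_neq0 l_gt0 n => H'; field; rewrite cn0 H'.
elim: m => [|m IH].
  rewrite big_ord1 -[l ord0]Lambda0 -(mulrA c) -/(t 0%N) [leRHS]mulrCA ler_pM2l//.
  exact: (dev_series_ge f_chord f_sign).
rewrite big_ord_recr/=.
apply: le_trans (lerD IH (lexx _)) _; rewrite addrC.
have -> : c * l m.+1 / L n = t m.+1 - t m by rewrite /t LambdaS; ring.
apply: dev_series_step => //.
rewrite /t [leRHS]mulrCA ler_pM2l// [leRHS]mulrA ler_pM2r ?invr_gt0//.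
exact: Lambda_ratio_le.
Qed.

(** A product of [m] factors [1 - theta], each tending to [q]. *)
Lemma Lambda_ratio_cvg m : L (k - m)%N / L k @[k --> \oo] --> q ^+ m.
Proof.
suff H : L n / L (n + m)%N @[n --> \oo] --> q ^+ m.
  rewrite -(cvg_shiftn m)/=.
  have -> // : (fun n => L (n + m - m)%N / L (n + m)%N) = (fun n => L n / L (n + m)%N).
  by apply/funext => n; rewrite addnK.
elim: m => [|m IH].
  have -> : (fun n => L n / L (n + 0)%N) = cst 1.
    by apply/funext => n; rewrite addn0 divff ?Lambda_neq0.
  exact: cvg_cst.
have H := theta_cvg; rewrite -(cvg_shiftn m.+1)/= in H.
have {}H : 1 - theta (n + m.+1)%N @[n --> \oo] --> q.
  by rewrite -[X in _ --> X](subKr 1); apply: cvgB => //; exact: cvg_cst.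
have -> : (fun n => L n / L (n + m.+1)%N) =
    (fun n => L n / L (n + m)%N * (1 - theta (n + m.+1)%N)).
  by apply/funext => n; rewrite addnS theta_onem// mulrA divfK// Lambda_neq0.
by rewrite exprSr; exact: cvgM IH H.
Qed.

Lemma Lambda_ratio_pow_le m k : (m <= k)%N -> L (k - m)%N / L k <= q ^+ m.
Proof.
elim: m => [|m IH] mk; first by rewrite subn0 divff// Lambda_neq0.
have E : (k - m)%N = (k - m.+1).+1 by rewrite subnSK.
apply: le_trans (_ : q * (L (k - m)%N / L k) <= _).
  by rewrite mulrA ler_pM2r ?invr_gt0// E Lambda_ratio_le.
by rewrite exprS ler_pM2l// IH// ltnW.
Qed.

(** Only the last [n] weights are kept: the other nodes are at most [q ^+ n <= b^-1] and contribute
    nonnegative terms. Raising the kept nodes to powers of [q] lowers the sum, and then [k] tends to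
    infinity. *)
Lemma dev_psum_le0 (b : R) n : 0 < b -> b * q ^+ n <= 1 ->
  (forall K, exists2 k, (K <= k)%N & \sum_(i < k.+1) l i * f (L k / (b * L i)) <= 0) ->
  P b n <= 0.
Proof.
move=> b0 bq inf.
pose A k := \sum_(m < n) theta (k - m)%N * (L (k - m)%N / L k) * f (b * q ^+ m)^-1.
have Ainf K : exists2 k, (K <= k)%N & A k <= 0.
  have [k Kk sk] := inf (maxn K n); exists k.
    by apply: leq_trans Kk; exact: leq_maxl.
  have nk : (n <= k)%N by apply: leq_trans Kk; exact: leq_maxr.
  rewrite -(pmulr_rle0 _ (L0 k)); apply: le_trans sk.
  rewrite (reindex_inj rev_ord_inj)/=.
  rewrite (eq_bigr (fun m : 'I_k.+1 => l (k - m)%N * f (L k / (b * L (k - m)%N)))); last first.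
    by move=> m _; rewrite subSS.
  rewrite -(big_mkord xpredT (fun m => l (k - m)%N * f (L k / (b * L (k - m)%N)))).
  rewrite (big_cat_nat (n := n))//=; last exact: leqW.
  rewrite ler_wpDr//.
    rewrite big_nat_cond sumr_ge0// => m /andP[/andP[nm]]; rewrite ltnS => mk _.
    rewrite mulr_ge0//; first exact: ltW.
    rewrite dev_sum_node; apply: (dev_inv_ge0 f_chord f_sign).
      by rewrite mulr_gt0// divr_gt0.
    apply: le_trans bq; rewrite ler_pM2l//; apply: le_trans (Lambda_ratio_pow_le mk) _.
    by rewrite ler_wiXn2l// ltW.
  rewrite big_mkord /A mulr_sumr; apply: ler_sum => m _.
  have mk : (m <= k)%N by apply: ltnW; apply: leq_trans nk.
  have -> : L k * (theta (k - m)%N * (L (k - m)%N / L k) * f (b * q ^+ m)^-1) =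
      l (k - m)%N * f (b * q ^+ m)^-1.
    by field; rewrite !Lambda_neq0.
  rewrite ler_pM2l// dev_sum_node; apply: (dev_inv_nincr f_chord f_sign).
    by rewrite mulr_gt0// divr_gt0.
  by rewrite ler_pM2l// Lambda_ratio_pow_le.
have Acvg : A k @[k --> \oo] --> (1 - q) * P b n.
  have -> : (1 - q) * P b n = \sum_(m < n) (1 - q) * q ^+ m * f (b * q ^+ m)^-1.
    by rewrite mulr_sumr; apply: eq_bigr => m _; rewrite mulrA.
  apply: (@cvg_sum_ord R n
    (fun m k => theta (k - m)%N * (L (k - m)%N / L k) * f (b * q ^+ m)^-1)
    (fun m => (1 - q) * q ^+ m * f (b * q ^+ m)^-1)) => m.
  apply: cvgMl; apply: cvgM; last exact: Lambda_ratio_cvg.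
  by rewrite (cvg_centern m (fun k => theta k)).
rewrite -(pmulr_rle0 _ q_onem) leNgt; apply/negP => pos.
have /cvgrPdist_lt /(_ _ pos) [K _ KP] := Acvg.
have [k Kk Ak] := Ainf K.
have /= := KP k Kk; have := ler_norm ((1 - q) * P b n - A k); lra.
Qed.

(** The dilation estimate turns the bound 0 for the partial sums at [b] into an upper bound at scale
    1, hence convergence; the sign is then a limit. *)
Lemma dev_series_le0 (b : R) : 1 <= b ->
  (forall K, exists2 k, (K <= k)%N & \sum_(i < k.+1) l i * f (L k / (b * L i)) <= 0) ->
  cvgn (P 1) /\ S b <= 0.
Proof.
move=> b1 inf; have b0 : 0 < b by lra.
have bV0 : 0 < b^-1 by rewrite invr_gt0.
have [N NP] := expr_small q0 q1 bV0.
have P0 n : (N <= n)%N -> P b n <= 0.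
  move=> Nn; apply: dev_psum_le0 => //.
  by rewrite -ler_pdivlMl// mulr1 ltW// NP.
have cv : cvgn (P 1).
  set e := `|f b^-1|; have e0 : 0 <= e by exact: normr_ge0.
  have f2b : 0 <= f (2 * b) by apply: (dev_ge0 f_chord f_sign); lra.
  apply: (@cvg_dev_psum _ _ _ f_chord f_sign q0 q1 1
    ((2 * b * e + f (2 * b)) * (1 - q)^-1)) => // n.
  (* The bound at [b] is known from [N] on only; smaller indices follow because the partial sums at
     1 are nondecreasing. *)
  pose m := maxn n N.
  apply: le_trans (_ : P 1 m <= _).
    by apply: dev_psum1_nd => //; exact: leq_maxl.
  apply: le_trans (_ : 2 * b * P b m + (2 * b * e + f (2 * b)) * \sum_(k < m) q ^+ k <= _).
    rewrite /dev_psum !mulr_sumr -big_split/=; apply: ler_sum => k _.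
    rewrite mul1r.
    have fk := dev_term_ge f_chord f_sign q0 q1 k b0.
    have qV : 0 < (q ^+ k)^-1 by rewrite invr_gt0.
    have := dev_dilation f_chord f_sign b1 qV; rewrite -invfM (mulrC (q ^+ k) b) => H.
    have H1 : Num.max (f (b * q ^+ k)^-1) 0 <= f (b * q ^+ k)^-1 + e.
      rewrite ge_max; apply/andP; split; first lra.
      by rewrite -/e in fk; lra.
    have H2 : f (q ^+ k)^-1 <= 2 * b * (f (b * q ^+ k)^-1 + e) + f (2 * b).
      apply: le_trans H _; rewrite lerD2r ler_wpM2l//; lra.
    apply: le_trans (ler_wpM2l (ltW (qX0 k)) H2) _.
    by rewrite le_eqVlt; apply/orP; left; apply/eqP; ring.
  rewrite -[leRHS]add0r lerD//.
    rewrite pmulr_rle0; last lra.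
    by apply: P0; exact: leq_maxr.
  rewrite ler_wpM2l ?geometric_psum_le//.
  by rewrite addr_ge0// mulr_ge0//; lra.
split=> //; apply: limr_le.
  by apply: (cvg_dev_psum_scaled f_chord f_sign q0 q1 b0).
by exists N => // n; exact: P0.
Qed.

End hardy_series.

(** * Positivity of the weights and the equivalence common to both cases *)

Section hardy_dichotomy.
Variables (R : realType) (f : R -> R) (l : R^nat).
Hypothesis f_chord : chord_concave [set x | 0 < x] f.
Hypothesis f_sign : forall x : R, 0 < x -> Num.sg (f x) = Num.sg (x - 1).
Hypothesis L_dvg : Lambda l n @[n --> \oo] --> +oo.
Hypothesis theta_nincr : nonincreasing_seq (fun n => l n / Lambda l n).

(* A zero weight would force all later ratios, hence all later weights, to vanish. *)
Lemma W0_weights_gt0 : W0 l -> forall n, 0 < l n.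
Proof.
move=> [l0 l_ge0] n; rewrite lt_neqAle l_ge0 andbT eq_sym; apply/eqP => ln0.
have LS m : Lambda l m.+1 = Lambda l m + l m.+1 by rewrite /Lambda big_ord_recr.
have Lpos m : 0 < Lambda l m.
  by rewrite /Lambda big_ord_recl ltr_wpDr// sumr_ge0.
have Lconst m : Lambda l (n + m) = Lambda l n.
  elim: m => [|m IH]; rewrite ?addn0// addnS LS IH.
  have := theta_nincr (leqW (leq_addr m n)); rewrite ln0 mul0r ler_pdivrMr// mul0r => H.
  by rewrite (le_anti (introT andP (conj H (l_ge0 _)))) addr0.
have [m nm] := Lambda_unbounded L_dvg (Lambda l n + 1) n.
by rewrite -(subnKC nm) Lconst; lra.
Qed.

Hypothesis l_gt0 : forall n, 0 < l n.

Lemma is_hardy_dev_sums : is_hardy l (qdev_mean f) ->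
  exists2 b, 1 <= b & forall K, exists2 k, (K <= k)%N &
    \sum_(i < k.+1) l i * f (Lambda l k / (b * Lambda l i)) <= 0.
Proof.
move=> [C [hC _] Coo].
have [b b1 Cb] : exists2 b : R, 1 <= b & (C <= b%:E)%E.
  case: C Coo {hC} => [C _||_] //.
    by exists (Num.max C 1); rewrite ?lee_fin le_max lexx ?orbT.
  by exists 1; rewrite ?leNye.
exists (b + 1); first lra.
move=> K; apply: (hardy_bound_partial_sums f_chord f_sign l_gt0 L_dvg K
  (hardy_bound_le l_gt0 Cb hC)); lra.
Qed.

(** [I] is the integrability condition; [Psi], a real-valued left side, need represent the equation
    only under [I]. *)
Lemma hardy_dichotomy (Psi : R -> R) (I : Prop) (eta : R) :
  (forall b, 1 <= b -> (forall K, exists2 k, (K <= k)%N &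
     \sum_(i < k.+1) l i * f (Lambda l k / (b * Lambda l i)) <= 0) -> I) ->
  (I -> forall c, 0 < c -> hardy_equation f eta c <-> Psi c = 0) ->
  (I -> exists2 c : R, is_hardy_constant l (qdev_mean f) c%:E &
    unique (fun c' => 0 < c' /\ Psi c' = 0) c) ->
  (is_hardy l (qdev_mean f) <-> I) /\
  (I -> exists2 c : R, is_hardy_constant l (qdev_mean f) c%:E &
    unique (fun c' : R => 0 < c' /\ hardy_equation f eta c') c).
Proof.
move=> sumsI eqn root; split; first split.
- by move=> /is_hardy_dev_sums[b b1]; exact: sumsI.
- by move=> /root[c hc _]; exists c%:E => //; exact: ltry.
move=> fi; have [c hc [[c0 Psic] uniq]] := root fi.
exists c => //; split; first by split => //; apply/eqn.
by move=> d [d0 /(eqn fi d d0) Psid]; exact: uniq.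
Qed.

End hardy_dichotomy.

Theorem theorem5p4 (R : realType) (lambda : R^nat) (eta : R) (f : R -> R)
    (lambda_W0 : W0 lambda)
    (Lambda_dvg : Lambda lambda n @[n --> \oo] --> +oo)
    (ratio_nincr : nonincreasing_seq (fun n => lambda n / Lambda lambda n))
    (ratio_cvg : lambda n / Lambda lambda n @[n --> \oo] --> eta)
    (eta01 : 0 <= eta < 1)
    (f_concave : concave_function `]0, +oo[ f)
    (f_sign : forall x : R, 0 < x -> Num.sg (f x) = Num.sg (x - 1)) :
  let f_integrable :=
    lebesgue_measure.-integrable `]0, 1] (fun x : R => (f x^-1)%:E) in
  (is_hardy lambda (qdev_mean f) <-> f_integrable) /\
  (f_integrable ->
    exists2 c : R, is_hardy_constant lambda (qdev_mean f) c%:E &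
      unique (fun c' : R => 0 < c' /\ hardy_equation f eta c') c).
Proof.
move=> f_integrable.
have f_chord : chord_concave [set x | 0 < x] f.
  by move=> x y z x0 z0; apply: (concave_function_chord f_concave); rewrite /= in_itv/= andbT.
have l_gt0 := W0_weights_gt0 Lambda_dvg ratio_nincr lambda_W0.
have [eta0|eta_neq0] := eqVneq eta 0.
  rewrite eta0 in ratio_cvg *.
  apply: (hardy_dichotomy f_chord f_sign Lambda_dvg l_gt0 (Psi := dev_integral f)).
  - move=> b b1 inf; have bb1 : b < b + 1 by lra.
    exact: (dev_integral_le0 f_chord f_sign l_gt0 Lambda_dvg ratio_cvg b1 bb1 inf).1.
  - by move=> fi c; exact: dev_integral_eq0.
  move=> fi; apply: (hardy_constant_root f_chord f_sign l_gt0 ratio_nincr Lambda_dvg).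
  - exact: dev_integral_chord.
  - by move=> c; exact: dev_integral_gt0.
  - exact: dev_integral_lt0.
  - move=> c c0 Psic n; have := dev_sum_le_integral f_chord f_sign l_gt0 n c0 fi.
    by rewrite Psic mulr0.
  - move=> b b' b1 bb' inf.
    exact: (dev_integral_le0 f_chord f_sign l_gt0 Lambda_dvg ratio_cvg b1 bb' inf).2.
have [eta_ge0 eta1] := andP eta01.
have eta0 : 0 < eta by rewrite lt_neqAle eq_sym eta_neq0.
pose q := 1 - eta; have qE : q = 1 - eta by [].
have q0 : 0 < q by rewrite subr_gt0.
have q1 : q < 1 by rewrite gtrBl.
have theta_cvg : lambda n / Lambda lambda n @[n --> \oo] --> 1 - q by rewrite /q subKr.
have cvgP : f_integrable -> cvgn (dev_psum f q 1).
  exact: integrable_cvg_dev_psum.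
apply: (hardy_dichotomy f_chord f_sign Lambda_dvg l_gt0 (Psi := dev_series f q)).
- move=> b b1 inf; apply: (cvg_dev_psum_integrable f_chord f_sign q0 q1).
  exact: (dev_series_le0 f_chord f_sign q0 q1 l_gt0 ratio_nincr theta_cvg b1 inf).1.
- by move=> /cvgP cv c c0; exact: dev_series_eq0.
move=> /cvgP cv; apply: (hardy_constant_root f_chord f_sign l_gt0 ratio_nincr Lambda_dvg).
- move=> x y z /= x1 z1; apply: (dev_series_chord f_chord f_sign q0 q1 cv) => /=; lra.
- by move=> c; exact: dev_series_gt0.
- exact: dev_series_lt0.
- move=> c c0 Psic n.
  have := dev_sum_le_series f_chord f_sign q0 q1 l_gt0 ratio_nincr theta_cvg n cv c0.
  by rewrite Psic mulr0.
- move=> b b' b1 bb' inf; have b0 : 0 < b by lra.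
  have [cv' Sb] := dev_series_le0 f_chord f_sign q0 q1 l_gt0 ratio_nincr theta_cvg b1 inf.
  (* The series is already nonpositive at [b]; monotonicity carries this to [b']. *)
  by apply: le_trans Sb; apply: dev_series_nincr => //; exact: ltW.
Qed.
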